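(* Let $0<\alpha<1$ and consider the problem described in the context with the mass density $\rho$ unknown (Case 4), the data $k,c,\ell>0$, $T_m$, $T_0>T_m$, $q_0>0$ being given. For any such data, the equation $$\frac{x\left[1-W\left(-x;-\frac{\alpha}{2},1\right)\right]}{M_{\alpha/2}(x)}=\frac{c(T_0-T_m)\,\Gamma\left(1-\frac{\alpha}{2}\right)}{\ell\,\Gamma\left(1+\frac{\alpha}{2}\right)},\quad x>0,$$ has a unique solution $\xi_\alpha>0$, and the solution of Case 4 is given by $$\rho=\rho_\alpha=\frac{q_0^2\,\Gamma^2\left(1-\frac{\alpha}{2}\right)}{kc(T_0-T_m)^2}\left[1-W\left(-\xi_\alpha;-\frac{\alpha}{2},1\right)\right]^2,$$ $$T_\alpha(x,t)=T_0-\frac{T_0-T_m}{1-W\left(-\xi_\alpha;-\frac{\alpha}{2},1\right)}\left[1-W\left(-\frac{x}{\lambda_\alpha t^{\alpha/2}};-\frac{\alpha}{2},1\right)\right],\qquad s_\alpha(t)=\lambda_\alpha\xi_\alpha t^{\alpha/2},$$ where $$\lambda_\alpha=\frac{k(T_0-T_m)}{q_0\,\Gamma\left(1-\frac{\alpha}{2}\right)\left[1-W\left(-\xi_\alpha;-\frac{\alpha}{2},1\right)\right]}.$$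
   Context: For $0<\alpha<1$ the Caputo fractional derivative of a function $f$ of $t$ is $D^\alpha f(t)=\frac{1}{\Gamma(1-\alpha)}\int_0^t \frac{f'(\tau)}{(t-\tau)^\alpha}\,d\tau$, where $\Gamma$ is Euler's Gamma function. The Wright function is $W(z;a,b)=\sum_{n=0}^{\infty}\frac{z^n}{n!\,\Gamma(na+b)}$ for $z\in\mathbb{C}$, $a>-1$, $b\in\mathbb{R}$; the Mainardi function is $M_\nu(z)=W(-z;-\nu,1-\nu)$ for $\nu<1$. The problem: $\rho,k,c,\ell$ are positive constants (density, conductivity, specific heat, latent heat), $\lambda^2=k/(\rho c)$, $T_m$ is the melting temperature, $T_0>T_m$ and $q_0>0$ are constants. Find $x=s(t)$, $T=T(x,t)$ and the unknown coefficient such that: $D^\alpha T=\lambda^2 T_{xx}$ for $0<x<s(t)$, $t>0$ (Caputo derivative in $t$); $s(0)=0$; $T(x,0)=T(+\infty,t)=T_m$ for $x>0,t>0$; $T(s(t),t)=T_m$; $-kT_x(s(t),t)=\rho\ell\, D^\alpha s(t)$; $T(0,t)=T_0$; $kT_x(0,t)=-q_0/t^{\alpha/2}$, for all $t>0$.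
   Formalization: T(x,0)=T(+∞,t)=T_m is required of the field equal to T_α for x≤s(t) and to T_m for x>s(t), since the formula T_α itself tends to T_0-(T_0-T_m)/(1-W(-ξ_α;-α/2,1))<T_m as x→+∞; the Caputo derivative of T still uses the formula at all earlier times. *)

(* Defs.v *)
From Stdlib Require Import Reals Factorial.
From Coquelicot Require Import Coquelicot.
Open Scope R_scope.

(* t^a for t > 0, with the convention t^a = 0 for t <= 0 (so that 0^a = 0
   for a > 0; Stdlib's Rpower 0 a would be 1). *)
Definition tpow (t a : R) : R :=
  match Rlt_dec 0 t with left _ => Rpower t a | right _ => 0 end.

Fixpoint poch (x : R) (n : nat) : R :=
  match n with
  | O => x
  | S m => poch x m * (x + INR (S m))
  end.

(* Reciprocal Gamma function 1/Gamma(x), defined for every real x by Gauss'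
   product formula  1/Gamma(x) = lim_n x(x+1)...(x+n) / (n! n^x)
   (it vanishes at the poles 0,-1,-2,...). *)
Definition rgamma (x : R) : R :=
  real (Lim_seq (fun n => poch x n / (INR (Factorial.fact n) * Rpower (INR n) x))).

(* Euler's Gamma function (used only at positive arguments). *)
Definition Gamma (x : R) : R := / rgamma x.

Definition Wright (z a b : R) : R :=
  Series (fun n => z ^ n / INR (Factorial.fact n) * rgamma (INR n * a + b)).

Definition Mainardi (nu z : R) : R := Wright (- z) (- nu) (1 - nu).

Definition is_caputo (a : R) (f : R -> R) (t v : R) : Prop :=
  (forall tau, 0 < tau < t -> ex_derive f tau) /\
  exists I : R,
    is_RInt_gen (fun tau => Derive f tau * Rpower (t - tau) (- a))
      (at_right 0) (at_left t) I /\
    v = I / Gamma (1 - a).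

(* Whole temperature field of the one-phase problem: liquid temperature T on
   0 <= x <= s(t), melting temperature Tm in the (solid) region x > s(t). *)
Definition phase_field (T : R -> R -> R) (s : R -> R) (Tm x t : R) : R :=
  match Rle_dec x (s t) with left _ => T x t | right _ => Tm end.

(* (rho, T, s) solves the fractional one-phase Stefan problem of the context
   (with lambda^2 = k/(rho c)). *)
Definition stefan_solution (alpha rho k c l Tm T0 q0 : R)
    (T : R -> R -> R) (s : R -> R) : Prop :=
  0 < rho /\
  s 0 = 0 /\
  (forall t, 0 < t -> 0 < s t) /\
  (forall x t, 0 < t -> 0 < x < s t ->
     exists D Txx, is_caputo alpha (fun tau => T x tau) t D /\
       is_derive_n (fun y => T y t) 2 x Txx /\
       D = k / (rho * c) * Txx) /\
  (forall x, 0 < x -> phase_field T s Tm x 0 = Tm) /\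
  (forall t, 0 < t -> is_lim (fun x => phase_field T s Tm x t) p_infty Tm) /\
  (forall t, 0 < t -> T (s t) t = Tm) /\
  (forall t, 0 < t -> exists Tx Ds,
     is_derive (fun y => T y t) (s t) Tx /\ is_caputo alpha s t Ds /\
     - k * Tx = rho * l * Ds) /\
  (forall t, 0 < t -> T 0 t = T0) /\
  (forall t, 0 < t -> exists Tx,
     is_derive (fun y => T y t) 0 Tx /\ k * Tx = - q0 / tpow t (alpha / 2)).

(* Main.v *)
Require Import Defs.
From Stdlib Require Import Reals Lra Lia Psatz.
From Coquelicot Require Import Coquelicot.
Open Scope R_scope.

(* Put beta = alpha / 2 and let (c)_n / n! denote the coefficients of (1 - z)^(-c).  By Gauss'
   product, n^(1-c) (c)_n / n! tends to 1 / Gamma(c).  Hence the coefficients of z^n in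
     (1 - z)^(-b) exp(-y (1 - z)^beta),   y = x n^beta,
   multiplied by n^(1-b), tend to W(-x; -beta, b), locally uniformly in x.  For b >= 0 these
   coefficients are nonnegative, so W(-x; -beta, b) >= 0; as d/dx W(-x; -beta, b) =
   -W(-x; -beta, b - beta), it follows that x -> x (1 - W(-x; -beta, 1)) increases while
   M_beta does not, which gives existence and uniqueness of xi.
   Multiplication by (1 - z)^(-p) is a convolution of coefficients, and its Riemann-sum limit is
     int_0^1 (1 - s)^(p-1) s^(b-1) W(-x s^(-beta); -beta, b) ds = Gamma(p) W(-x; -beta, b + p).
   With p = 1 - alpha this computes both Caputo derivatives: b = 0 for the temperature, and
   b = beta, x = 0 for the free boundary. *)

(** * Rising factorials and Gauss' product *)

(** Integrating the Wright series term by term is not possible: the term of index j carries tau^(b -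
    1 - beta j), and this power is not integrable at 0 once beta j >= b. In the discrete version the
    term of index j is a coefficient of (1 - z)^(beta j - b), Vandermonde's identity holds for all
    real exponents, and near the ends only the total is estimated, where nonnegativity lets a
    partial sum be compared with a full one. The same discretisation supplies the positivity, which
    the series, with terms of varying sign, hides. The price is that 1 / Gamma must be controlled at
    b - beta j, which tends to minus infinity, uniformly along Gauss' sequence. Elementary bounds by
    harmonic numbers give a growth of about j^(2 beta j), twice the true exponent; divided by j!
    this is still summable because 2 beta = alpha < 1. *)

Fixpoint rise (c : R) (n : nat) : R :=
  match n with
  | O => 1
  | S m => rise c m * (c + INR m) / INR (S m)
  end.

Lemma INR_S_pos (n : nat) : 0 < INR (S n).
Proof. apply lt_0_INR; lia. Qed.

Lemma rise_S (c : R) (n : nat) : rise c (S n) = rise c n * (c + INR n) / INR (S n).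
Proof. reflexivity. Qed.

Lemma rise_step (c : R) (n : nat) : INR (S n) * rise c (S n) = (c + INR n) * rise c n.
Proof. rewrite rise_S. field. apply Rgt_not_eq, INR_S_pos. Qed.

Lemma rise_shift (c : R) (n : nat) : c * rise (c + 1) n = (c + INR n) * rise c n.
Proof.
  induction n as [|n IH]; [simpl; ring|].
  pose proof (INR_S_pos n).
  rewrite !rise_S, S_INR in *.
  replace (c * (rise (c + 1) n * (c + 1 + INR n) / (INR n + 1)))
    with (c * rise (c + 1) n * (c + 1 + INR n) / (INR n + 1)) by (field; lra).
  rewrite IH. field; lra.
Qed.

Lemma rise_nonneg (c : R) (n : nat) : 0 <= c -> 0 <= rise c n.
Proof.
  intros hc; induction n as [|n IH]; [simpl; lra|].
  pose proof (INR_S_pos n); pose proof (pos_INR n).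
  rewrite rise_S. apply Rmult_le_pos; [apply Rmult_le_pos; lra|].
  apply Rlt_le, Rinv_0_lt_compat; auto.
Qed.

Lemma rise_1 (n : nat) : rise 1 n = 1.
Proof.
  induction n as [|n IH]; [reflexivity|].
  rewrite rise_S, IH. pose proof (INR_S_pos n). rewrite S_INR in *. field; lra.
Qed.

Lemma rise_0 (n : nat) : rise 0 (S n) = 0.
Proof.
  induction n as [|n IH]; [simpl; field|].
  change (rise 0 (S n) * (0 + INR (S n)) / INR (S (S n)) = 0). rewrite IH.
  unfold Rdiv; ring.
Qed.

(** Coefficients of (1 - z)^(-p) (1 - z)^(-q). The induction is Leibniz' rule for z d/dz: after
    multiplication by n + 1, the split n + 1 = (n + 1 - k) + k lets [rise_step] act on one factor at
    a time. *)
Lemma vandermonde (p q : R) (n : nat) :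
  sum_f_R0 (fun k => rise p (n - k) * rise q k) n = rise (p + q) n.
Proof.
  induction n as [|n IH]; [simpl; ring|].
  pose proof (INR_S_pos n) as hn.
  apply (Rmult_eq_reg_l (INR (S n))); [|lra].
  rewrite rise_step, <- IH.
  rewrite scal_sum.
  rewrite (sum_eq _ (fun k => INR (S n - k) * rise p (S n - k) * rise q k
                              + rise p (S n - k) * (INR k * rise q k))).
  2:{ intros k hk. rewrite minus_INR by lia. ring. }
  rewrite sum_plus.
  rewrite (tech5 _ n), Nat.sub_diag.
  rewrite (decomp_sum (fun k => rise p (S n - k) * (INR k * rise q k))) by lia.
  simpl pred. simpl (INR 0).
  rewrite Rmult_0_l, Rmult_0_l, Rmult_0_l, Rmult_0_r, Rplus_0_r, Rplus_0_l.
  rewrite <- sum_plus, scal_sum. apply sum_eq. intros k hk.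
  replace (S n - k)%nat with (S (n - k)) by lia.
  replace (S n - S k)%nat with (n - k)%nat by lia.
  rewrite !rise_step, minus_INR by lia. ring.
Qed.

(** Limits and bounds are stated at [S n], because at n = 0 the power involves ln 0. Unrelated to
    the density [rho] of the final theorem. *)
Definition rho (c : R) (n : nat) : R := rise c n * Rpower (INR n) (1 - c).

Lemma rise_rho (c : R) (n : nat) : rise c n = Rpower (INR n) (c - 1) * rho c n.
Proof.
  unfold rho. replace (1 - c) with (- (c - 1)) by ring.
  rewrite Rpower_Ropp. field. apply Rgt_not_eq, exp_pos.
Qed.

Lemma poch_rise (c : R) (n : nat) :
  poch c n = INR (Factorial.fact n) * ((c + INR n) * rise c n).
Proof.
  induction n as [|n IH]; [simpl; ring|].
  change (poch c (S n)) with (poch c n * (c + INR (S n))). rewrite IH.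
  rewrite <- rise_step. rewrite fact_simpl, mult_INR. ring.
Qed.

(** [poch c n] has n + 1 factors, one more than (c)_n; the surplus factor c + n, divided by n, is
    harmless because it tends to 1. *)
Lemma gauss_rho (c : R) (n : nat) :
  poch c (S n) / (INR (Factorial.fact (S n)) * Rpower (INR (S n)) c)
  = rho c (S n) * (1 + c / INR (S n)).
Proof.
  rewrite poch_rise. unfold rho.
  pose proof (INR_S_pos n). pose proof (INR_fact_neq_0 (S n)).
  unfold Rminus. rewrite Rpower_plus, Rpower_1, Rpower_Ropp by auto.
  field. repeat split; auto; try lra. apply Rgt_not_eq, exp_pos.
Qed.

Lemma rho_shift (c : R) (n : nat) :
  c * rho (c + 1) (S n) = rho c (S n) * (1 + c / INR (S n)).
Proof.
  unfold rho. rewrite <- Rmult_assoc, rise_shift.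
  pose proof (INR_S_pos n).
  replace (1 - (c + 1)) with (1 - c + - (1)) by ring.
  rewrite Rpower_plus, Rpower_Ropp, Rpower_1 by auto.
  field; lra.
Qed.

Lemma is_lim_seq_inv_INR (c : R) : is_lim_seq (fun n => c / INR (S n)) 0.
Proof.
  apply (is_lim_seq_incr_1 (fun n => c / INR n)).
  replace (Finite 0) with (Rbar_mult c 0) by (simpl; f_equal; ring).
  apply (is_lim_seq_scal_l (fun n => / INR n)).
  replace (Finite 0) with (Rbar_inv p_infty) by reflexivity.
  apply is_lim_seq_inv; [apply is_lim_seq_INR|discriminate].
Qed.

Lemma is_lim_seq_one_plus (c : R) : is_lim_seq (fun n => 1 + c / INR (S n)) 1.
Proof.
  replace (Finite 1) with (Rbar_plus 1 0) by (simpl; f_equal; ring).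
  apply is_lim_seq_plus'; [apply is_lim_seq_const|apply is_lim_seq_inv_INR].
Qed.

Lemma Rpower_pos (x y : R) : 0 < Rpower x y.
Proof. apply exp_pos. Qed.

(** For 0 < c <= 1 Bernoulli's inequality makes this ratio at least 1, so Gauss' sequence increases
    there. *)
Lemma rho_step (c : R) (n : nat) :
  rho c (S (S n)) =
  rho c (S n) * ((1 + c / INR (S n)) / Rpower (1 + / INR (S n)) c).
Proof.
  unfold rho. rewrite (rise_S c (S n)).
  pose proof (INR_S_pos n).
  assert (0 < / INR (S n)) by (apply Rinv_0_lt_compat; auto).
  replace (INR (S (S n))) with (INR (S n) * (1 + / INR (S n))).
  2:{ rewrite (S_INR (S n)). field; lra. }
  rewrite <- Rpower_mult_distr by lra.
  replace (Rpower (1 + / INR (S n)) (1 - c))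
    with ((1 + / INR (S n)) / Rpower (1 + / INR (S n)) c).
  2:{ unfold Rminus. rewrite Rpower_plus, Rpower_1, Rpower_Ropp by lra. reflexivity. }
  field. repeat split; try lra. apply Rgt_not_eq, Rpower_pos.
Qed.

(** * Harmonic numbers and bounds uniform along Gauss' sequence *)

Fixpoint harm (n : nat) : R :=
  match n with
  | O => 0
  | S m => harm m + / INR (S m)
  end.

Lemma harm_S (n : nat) : harm (S n) = harm n + / INR (S n).
Proof. reflexivity. Qed.

Lemma inv_INR_S_pos (n : nat) : 0 < / INR (S n).
Proof. apply Rinv_0_lt_compat, INR_S_pos. Qed.

Lemma harm_le (m n : nat) : (m <= n)%nat -> harm m <= harm n.
Proof.
  induction 1 as [|n _ IH]; [lra|]. rewrite harm_S. pose proof (inv_INR_S_pos n). lra.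
Qed.

Lemma exp_le_le (x y : R) : x <= y -> exp x <= exp y.
Proof. intros [h| ->]; [apply Rlt_le, exp_increasing; auto|lra]. Qed.

Lemma ln_le_sub_1 (x : R) : 0 < x -> ln x <= x - 1.
Proof. intros hx. pose proof (exp_ineq1_le (ln x)) as h. rewrite exp_ln in h; lra. Qed.

Lemma ln_le_harm (n : nat) : ln (INR (S n)) <= harm n.
Proof.
  induction n as [|n IH]; [simpl; rewrite ln_1; lra|].
  pose proof (INR_S_pos n). pose proof (inv_INR_S_pos n).
  rewrite harm_S.
  replace (INR (S (S n))) with (INR (S n) * (1 + / INR (S n)))
    by (rewrite (S_INR (S n)); field; lra).
  rewrite ln_mult by lra. pose proof (ln_le_sub_1 (1 + / INR (S n))). lra.
Qed.

Lemma harm_le_ln (n : nat) : harm n <= 1 + ln (INR (S n)).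
Proof.
  (* The induction runs on a sharper inequality, with equality at n = 0. *)
  assert (h : harm (S n) <= 1 + ln (INR (S n))).
  { induction n as [|n IH]; [simpl; rewrite ln_1; lra|].
    pose proof (INR_S_pos n). pose proof (INR_S_pos (S n)). pose proof (inv_INR_S_pos (S n)).
    rewrite harm_S.
    assert (e : INR (S n) = INR (S (S n)) * (1 - / INR (S (S n))))
      by (rewrite (S_INR (S n)); field; rewrite S_INR in *; lra).
    assert (0 < 1 - / INR (S (S n))).
    { apply (Rmult_lt_reg_l (INR (S (S n)))); [lra|]. rewrite <- e; lra. }
    rewrite e in IH. rewrite ln_mult in IH by lra.
    pose proof (ln_le_sub_1 (1 - / INR (S (S n)))). lra. }
  pose proof (harm_le n (S n)). assert (harm n <= harm (S n)) by (apply harm_le; lia). lra.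
Qed.

(* The factors of [rise c (S m)] that tend to 1. *)
Fixpoint gprod (c : R) (m : nat) : R :=
  match m with
  | O => 1
  | S k => gprod c k * (1 + c / INR (S k))
  end.

Lemma gprod_S (c : R) (m : nat) : gprod c (S m) = gprod c m * (1 + c / INR (S m)).
Proof. reflexivity. Qed.

Lemma rise_gprod (c : R) (m : nat) : INR (S m) * rise c (S m) = c * gprod c m.
Proof.
  induction m as [|m IH]; [simpl; field|].
  rewrite rise_step, gprod_S. pose proof (INR_S_pos m).
  apply (Rmult_eq_reg_l (INR (S m))); [|lra].
  transitivity ((c + INR (S m)) * (INR (S m) * rise c (S m))); [ring|].
  rewrite IH. field. lra.
Qed.

Lemma rho_gprod (c : R) (m : nat) :
  rho c (S m) = c * gprod c m * exp (- c * ln (INR (S m))).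
Proof.
  unfold rho. pose proof (INR_S_pos m). unfold Rminus.
  rewrite Rpower_plus, Rpower_1 by auto.
  rewrite <- rise_gprod. unfold Rpower. ring.
Qed.

(* For [i > N >= s] the factor [1 + (b - s) / i] is positive and at most [exp ((b - s) / i)];
   the finitely many others are bounded by [exp ((b + s) / i)]. *)
Lemma gprod_bound (b s : R) (N m : nat) : 0 <= b -> 0 <= s <= INR N ->
  Rabs (gprod (b - s) m) <= exp ((b - s) * harm m + 2 * s * harm (Nat.min m N)).
Proof.
  intros hb hs. induction m as [|m IH].
  { simpl. rewrite Rabs_R1. replace (_ + _) with 0 by ring. rewrite exp_0; lra. }
  pose proof (INR_S_pos m) as hm. pose proof (inv_INR_S_pos m) as hi.
  rewrite gprod_S, Rabs_mult.
  set (i := / INR (S m)) in *.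
  destruct (Nat.le_gt_cases (S m) N) as [h|h].
  - rewrite Nat.min_l in * by lia. rewrite !harm_S. fold i.
    replace ((b - s) * (harm m + i) + 2 * s * (harm m + i))
      with (((b - s) * harm m + 2 * s * harm m) + (b + s) * i) by ring.
    rewrite exp_plus. apply Rmult_le_compat; try apply Rabs_pos; auto.
    pose proof (exp_ineq1_le ((b + s) * i)).
    unfold Rdiv. fold i. apply Rabs_le. nra.
  - replace (Nat.min (S m) N) with (Nat.min m N) by lia. rewrite harm_S. fold i.
    replace ((b - s) * (harm m + i) + 2 * s * harm (Nat.min m N))
      with (((b - s) * harm m + 2 * s * harm (Nat.min m N)) + (b - s) * i) by ring.
    rewrite exp_plus. apply Rmult_le_compat; try apply Rabs_pos; auto.
    pose proof (exp_ineq1_le ((b - s) * i)).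
    assert (s * i <= 1).
    { apply (Rmult_le_reg_r (INR (S m))); [auto|]. unfold i. rewrite Rmult_assoc, Rinv_l by lra.
      assert (INR N <= INR (S m)) by (apply le_INR; lia). lra. }
    unfold Rdiv. fold i. rewrite Rabs_pos_eq; [|nra]. lra.
Qed.

(** Uniform in m: as 0 <= H_m - ln (m + 1) <= 1, the exponent (b - s) H_m of [gprod_bound] and the
    power (m + 1)^(s - b) cancel up to a factor of at most exp b. Later s = beta j and N = j. *)
Lemma rho_bound (b s : R) (N m : nat) : 0 <= b -> 0 <= s <= INR N ->
  Rabs (rho (b - s) (S m)) <= (b + s) * exp (b + 2 * s * harm N).
Proof.
  intros hb hs. rewrite rho_gprod, !Rabs_mult.
  rewrite (Rabs_pos_eq (exp _)) by apply Rlt_le, exp_pos.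
  rewrite Rmult_assoc. apply Rmult_le_compat; try apply Rabs_pos.
  - apply Rmult_le_pos; [apply Rabs_pos|apply Rlt_le, exp_pos].
  - apply Rabs_le; lra.
  - eapply Rle_trans.
    { apply Rmult_le_compat_r; [apply Rlt_le, exp_pos|]. apply (gprod_bound b s N m); auto. }
    rewrite <- exp_plus. apply exp_le_le.
    pose proof (ln_le_harm m). pose proof (harm_le_ln m).
    assert (harm (Nat.min m N) <= harm N) by (apply harm_le; lia).
    nra.
Qed.

(** * Convergence of Gauss' sequence at every real argument, and the recurrence of 1 / Gamma *)

Lemma Rpower_bernoulli (x h : R) : 0 <= x <= 1 -> 0 <= h -> Rpower (1 + h) x <= 1 + x * h.
Proof.
  intros hx hh. unfold Rpower. set (u := ln (1 + h)).
  assert (eu : 1 + h = exp u) by (unfold u; rewrite exp_ln; lra).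
  assert (h1 : exp u = exp (x * u) * exp ((1 - x) * u)) by (rewrite <- exp_plus; f_equal; ring).
  assert (h2 : 1 = exp (x * u) * exp (- (x * u))) by (rewrite <- exp_plus, Rplus_opp_r, exp_0; auto).
  pose proof (exp_ineq1_le ((1 - x) * u)) as i1.
  pose proof (exp_ineq1_le (- (x * u))) as i2.
  pose proof (exp_pos (x * u)) as p.
  assert (exp (x * u) * (1 + (1 - x) * u) <= exp u) by (rewrite h1; apply Rmult_le_compat_l; lra).
  assert (exp (x * u) * (1 - x * u) <= 1) by (rewrite h2 at 2; apply Rmult_le_compat_l; lra).
  (* In x times the first tangent inequality plus 1 - x times the second, the terms linear in u
     cancel. *)
  replace (1 + x * h) with (x * exp u + (1 - x)) by (rewrite <- eu; ring).
  nra.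
Qed.

Lemma rho_incr (c : R) (n : nat) : 0 < c <= 1 -> rho c (S n) <= rho c (S (S n)).
Proof.
  intros hc. rewrite rho_step.
  pose proof (inv_INR_S_pos n).
  assert (0 <= rho c (S n)).
  { apply Rmult_le_pos; [apply rise_nonneg; lra|apply Rlt_le, Rpower_pos]. }
  rewrite <- (Rmult_1_r (rho c (S n))) at 1. apply Rmult_le_compat_l; auto.
  apply (Rmult_le_reg_r (Rpower (1 + / INR (S n)) c)); [apply Rpower_pos|].
  unfold Rdiv at 1. rewrite Rmult_assoc, Rinv_l, Rmult_1_r, Rmult_1_l
    by apply Rgt_not_eq, Rpower_pos.
  apply Rpower_bernoulli; lra.
Qed.

Lemma rho_1 (c : R) : rho c 1 = c.
Proof. unfold rho. simpl. unfold Rpower. rewrite ln_1, Rmult_0_r, exp_0. field. Qed.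

(** An increasing sequence, bounded by [rho_bound] with s = 0. It starts at c, and this makes the
    limit positive. *)
Lemma rho_cvg_unit (c : R) : 0 < c <= 1 ->
  exists l : R, 0 < l /\ is_lim_seq (fun n => rho c (S n)) l.
Proof.
  intros hc.
  destruct (ex_finite_lim_seq_incr (fun n => rho c (S n)) ((c + 0) * exp (c + 2 * 0 * harm 0)))
    as [l hl].
  - intros n; apply rho_incr; auto.
  - intros n. eapply Rle_trans; [apply Rle_abs|].
    replace c with (c - 0) at 1 by ring. apply rho_bound; simpl; lra.
  - exists l; split; auto.
    apply Rlt_le_trans with c; [lra|]. rewrite <- (rho_1 c).
    apply (is_lim_seq_incr_compare (fun n => rho c (S n)) l hl); intros; apply rho_incr; auto.
Qed.

(** Going down requires no division by c, so it passes through the poles 0, -1, -2, ... as well;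
    only 1 + c / n must be nonzero, which holds for n > |c|. *)
Lemma rho_cvg_down (c l : R) :
  is_lim_seq (fun n => rho (c + 1) (S n)) l -> is_lim_seq (fun n => rho c (S n)) (c * l).
Proof.
  intros h.
  assert (h2 : is_lim_seq (fun n => c * rho (c + 1) (S n) / (1 + c / INR (S n))) (c * l / 1)).
  { apply is_lim_seq_div'; [|apply is_lim_seq_one_plus|lra].
    apply (is_lim_seq_scal_l _ c l h). }
  rewrite Rdiv_1_r in h2.
  refine (is_lim_seq_ext_loc _ _ _ _ h2).
  destruct (nfloor_ex (Rabs c) (Rabs_pos c)) as [N hN].
  exists (S N). intros n hn. rewrite rho_shift. field.
  assert (INR (S N) <= INR (S n)) by (apply le_INR; lia). rewrite S_INR in H.
  pose proof (Rle_abs (- c)). rewrite Rabs_Ropp in *. pose proof (INR_S_pos n).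
  split; lra.
Qed.

Lemma rho_cvg_up (c l : R) : c <> 0 ->
  is_lim_seq (fun n => rho c (S n)) l -> is_lim_seq (fun n => rho (c + 1) (S n)) (l / c).
Proof.
  intros hc h.
  assert (h2 : is_lim_seq (fun n => (rho c (S n) * (1 + c / INR (S n))) * / c) (l * 1 * / c)).
  { apply (is_lim_seq_scal_r _ (/ c) (l * 1)).
    apply is_lim_seq_mult'; [auto|apply is_lim_seq_one_plus]. }
  rewrite Rmult_1_r in h2.
  refine (is_lim_seq_ext _ _ _ _ h2).
  intros n. rewrite <- rho_shift. field; auto.
Qed.

(** Monotonicity settles (0, 1] only; unit steps up reach all c > 0, and unit steps down reach the
    rest. *)
Lemma rho_cvg_ex (c : R) : exists l : R, is_lim_seq (fun n => rho c (S n)) l.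
Proof.
  assert (up : forall n c, 0 < c <= INR (S n) -> exists l : R, is_lim_seq (fun n => rho c (S n)) l).
  { induction n as [|n IH]; intros x hx.
    - destruct (rho_cvg_unit x) as [l [_ hl]]; [simpl in hx; lra|eauto].
    - destruct (Rle_lt_dec x 1).
      + destruct (rho_cvg_unit x) as [l [_ hl]]; [lra|eauto].
      + destruct (IH (x - 1)) as [l hl]; [rewrite S_INR in hx; lra|].
        exists (l / (x - 1)). assert (h : x - 1 <> 0) by lra.
        pose proof (rho_cvg_up (x - 1) l h hl) as h2.
        replace (x - 1 + 1) with x in h2 by ring. exact h2. }
  assert (pos : forall c, 0 < c -> exists l : R, is_lim_seq (fun n => rho c (S n)) l).
  { intros x hx. destruct (nfloor_ex x) as [n hn]; [lra|].
    apply (up n). rewrite S_INR; lra. }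
  assert (down : forall n c, - INR n < c -> exists l : R, is_lim_seq (fun n => rho c (S n)) l).
  { induction n as [|n IH]; intros x hx; [apply pos; simpl in hx; lra|].
    destruct (IH (x + 1)) as [l hl]; [rewrite S_INR in hx; lra|].
    exists (x * l). apply rho_cvg_down; auto. }
  destruct (nfloor_ex (Rabs c) (Rabs_pos c)) as [n hn].
  apply (down (S n)). rewrite S_INR. pose proof (Rle_abs (- c)). rewrite Rabs_Ropp in *. lra.
Qed.

Lemma rho_cvg_rgamma (c l : R) : is_lim_seq (fun n => rho c (S n)) l -> rgamma c = l.
Proof.
  intros h. unfold rgamma.
  rewrite (is_lim_seq_unique _ l); [reflexivity|].
  apply is_lim_seq_incr_1.
  apply (is_lim_seq_ext (fun n => rho c (S n) * (1 + c / INR (S n)))).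
  { intros n. symmetry; apply gauss_rho. }
  rewrite <- (Rmult_1_r l).
  apply is_lim_seq_mult'; [auto|apply is_lim_seq_one_plus].
Qed.

Lemma rho_cvg (c : R) : is_lim_seq (fun n => rho c (S n)) (rgamma c).
Proof.
  destruct (rho_cvg_ex c) as [l hl]. rewrite (rho_cvg_rgamma c l); auto.
Qed.

Lemma rgamma_rec (c : R) : rgamma c = c * rgamma (c + 1).
Proof. apply rho_cvg_rgamma, rho_cvg_down, rho_cvg. Qed.

Lemma rgamma_pos_unit (c : R) : 0 < c <= 1 -> 0 < rgamma c.
Proof.
  intros hc. destruct (rho_cvg_unit c hc) as [l [hl h]]. rewrite (rho_cvg_rgamma c l); auto.
Qed.

Lemma rgamma_1 : rgamma 1 = 1.
Proof.
  apply rho_cvg_rgamma. apply (is_lim_seq_ext (fun _ => 1)); [|apply is_lim_seq_const].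
  intros n. unfold rho. rewrite rise_1, Rminus_diag, Rpower_O; [ring|apply INR_S_pos].
Qed.

(** * Dominated convergence of series *)

Lemma sum_f_R0_lim_0 (u : nat -> nat -> R) (n : nat) :
  (forall j, is_lim_seq (fun m => u m j) 0) -> is_lim_seq (fun m => sum_f_R0 (u m) n) 0.
Proof.
  intros h; induction n as [|n IH]; simpl; [apply h|].
  rewrite <- (Rplus_0_r 0). apply is_lim_seq_plus'; auto.
Qed.

Lemma Series_tail_lim_0 (a : nat -> R) : ex_series a ->
  is_lim_seq (fun n => Series (fun k => a (S n + k)%nat)) 0.
Proof.
  intros h. pose proof (Series_correct a h) as h1.
  apply (is_lim_seq_ext (fun n => Series a - sum_n a n)).
  { intros n. rewrite (Series_incr_n a (S n)) by (auto; lia). rewrite sum_n_Reals.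
    simpl Init.Nat.pred. ring. }
  rewrite <- (Rminus_diag (Series a)).
  apply is_lim_seq_minus'; [apply is_lim_seq_const|exact h1].
Qed.

(** An l^1 distance rather than convergence of sums: with weights X^j / j! it bounds the difference
    of two power series for all |x| <= X at once. The head tends to 0 termwise, the tail is below
    that of 2 M. *)
Lemma tannery (u : nat -> nat -> R) (v M : nat -> R) :
  (forall m j, Rabs (u m j) <= M j) -> ex_series M ->
  (forall j, is_lim_seq (fun m => u m j) (v j)) ->
  is_lim_seq (fun m => Series (fun j => Rabs (u m j - v j))) 0.
Proof.
  intros hu hM hv.
  assert (hvM : forall j, Rabs (v j) <= M j).
  { intros j.
    apply (is_lim_seq_le (fun m => Rabs (u m j)) (fun _ => M j) (Rabs (v j)) (M j)).
    - intros m; apply hu.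
    - apply (is_lim_seq_abs _ (v j)); auto.
    - apply is_lim_seq_const. }
  set (M2 := fun j => M j + M j).
  assert (hM2 : ex_series M2) by (apply (ex_series_plus M M); auto).
  assert (hw : forall m j, 0 <= Rabs (u m j - v j) <= M2 j).
  { intros m j; split; [apply Rabs_pos|]. unfold Rminus, M2.
    eapply Rle_trans; [apply Rabs_triang|]. rewrite Rabs_Ropp.
    apply Rplus_le_compat; auto. }
  assert (hex : forall m, ex_series (fun j => Rabs (u m j - v j))).
  { intros m. apply (@ex_series_le R_AbsRing R_CompleteNormedModule _ M2); auto.
    intros j. change (norm ?z) with (Rabs z). rewrite Rabs_Rabsolu. apply hw. }
  apply is_lim_seq_spec. intros eps.
  pose proof (Series_tail_lim_0 M2 hM2) as ht. apply is_lim_seq_spec in ht.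
  destruct (ht (pos_div_2 eps)) as [N hN]. specialize (hN N (Nat.le_refl N)).
  change (pos (pos_div_2 eps)) with (eps / 2) in hN.
  assert (hs : is_lim_seq (fun m => sum_f_R0 (fun j => Rabs (u m j - v j)) N) 0).
  { apply (sum_f_R0_lim_0 (fun m j => Rabs (u m j - v j))). intros j. rewrite <- Rabs_R0.
    apply (is_lim_seq_abs (fun m => u m j - v j) 0). rewrite <- (Rminus_diag (v j)).
    apply is_lim_seq_minus'; [auto|apply is_lim_seq_const]. }
  apply is_lim_seq_spec in hs. destruct (hs (pos_div_2 eps)) as [m0 hm0].
  exists m0. intros m hm. specialize (hm0 m hm). simpl in hm0.
  rewrite Rminus_0_r in *.
  rewrite (Series_incr_n _ (S N)) by (auto; lia). simpl Init.Nat.pred.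
  assert (0 <= Series (fun k => Rabs (u m (S N + k)%nat - v (S N + k)%nat))
          <= Series (fun k => M2 (S N + k)%nat)).
  { assert (ex_series (fun k => M2 (S N + k)%nat)) by (apply (ex_series_incr_n M2); auto).
    split; [|apply Series_le; auto].
    eapply Rle_trans; [apply Rabs_pos|].
    apply (Series_Rabs (fun k => u m (S N + k)%nat - v (S N + k)%nat)).
    apply (ex_series_incr_n (fun k => Rabs (u m k - v k))); auto. }
  rewrite Rabs_pos_eq.
  2:{ apply Rplus_le_le_0_compat; [apply cond_pos_sum; intros; apply Rabs_pos|lra]. }
  apply Rabs_def2 in hN. apply Rabs_def2 in hm0. lra.
Qed.

(** This is [rho_bound] with s = beta j and N = j, after b + beta j <= (b + 1) 2^j; a power of 2 has
    a constant ratio, which suits the ratio test. *)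
Definition maj (beta b : R) (j : nat) : R :=
  (b + 1) * exp b * (2 ^ j * exp (2 * beta * INR j * harm j)).

Lemma INR_le_pow2 (j : nat) : INR j + 1 <= 2 ^ j.
Proof.
  induction j as [|j IH]; [simpl; lra|]. rewrite S_INR. simpl pow. pose proof (pos_INR j). lra.
Qed.

Lemma rho_maj (beta b : R) (j m : nat) : 0 < beta <= 1 -> 0 <= b ->
  Rabs (rho (INR j * - beta + b) (S m)) <= maj beta b j.
Proof.
  intros hbeta hb. pose proof (pos_INR j).
  replace (INR j * - beta + b) with (b - INR j * beta) by ring.
  eapply Rle_trans; [apply (rho_bound b (INR j * beta) j m); nra|].
  rewrite exp_plus. unfold maj.
  replace (2 * (INR j * beta) * harm j) with (2 * beta * INR j * harm j) by ring.
  pose proof (INR_le_pow2 j).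
  replace ((b + 1) * exp b * (2 ^ j * exp (2 * beta * INR j * harm j)))
    with ((b + 1) * 2 ^ j * (exp b * exp (2 * beta * INR j * harm j))) by ring.
  apply Rmult_le_compat_r.
  - apply Rmult_le_pos; apply Rlt_le, exp_pos.
  - apply Rle_trans with ((b + 1) * (INR j + 1)); [nra|]. apply Rmult_le_compat_l; lra.
Qed.

Lemma maj_ge_1 (beta b : R) (j : nat) : 0 <= beta -> 0 <= b -> 1 <= maj beta b j.
Proof.
  intros hbeta hb. unfold maj.
  assert (e : forall x, 0 <= x -> 1 <= exp x) by (intros x hx; pose proof (exp_ineq1_le x); lra).
  pose proof (pos_INR j). pose proof (INR_le_pow2 j).
  assert (h0 : 0 <= harm j) by (apply (harm_le 0 j); lia).
  assert (1 <= exp b) by auto.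
  assert (1 <= exp (2 * beta * INR j * harm j)).
  { apply e. repeat apply Rmult_le_pos; lra. }
  assert (mul : forall x y, 1 <= x -> 1 <= y -> 1 <= x * y) by (intros; nra).
  repeat apply mul; lra.
Qed.

Lemma Rpower_neg_lim_0 (a : R) : 0 < a -> is_lim_seq (fun n => Rpower (INR (S n)) (- a)) 0.
Proof.
  intros ha. apply is_lim_seq_spec. intros eps.
  destruct (nfloor_ex (Rpower eps (- / a)) (Rlt_le _ _ (Rpower_pos _ _))) as [N hN].
  exists N. intros n hn. rewrite Rminus_0_r, Rabs_pos_eq by apply Rlt_le, Rpower_pos.
  assert (h : Rpower eps (- / a) < INR (S n)).
  { apply Rlt_le_trans with (INR N + 1); [lra|]. rewrite <- S_INR. apply le_INR; lia. }
  rewrite Rpower_Ropp.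
  replace (pos eps) with (/ / eps) by apply Rinv_inv.
  apply Rinv_lt_contravar.
  { apply Rmult_lt_0_compat; [apply Rinv_0_lt_compat, cond_pos|apply Rpower_pos]. }
  replace (/ eps) with (Rpower (Rpower eps (- / a)) a).
  - apply Rlt_Rpower_l; auto. split; [apply Rpower_pos|auto].
  - rewrite Rpower_mult. replace (- / a * a) with (- (1)) by (field; lra).
    rewrite Rpower_Ropp, Rpower_1; auto. apply cond_pos.
Qed.

Lemma fact_inv_pos (j : nat) : 0 < / INR (Factorial.fact j).
Proof. apply Rinv_0_lt_compat, INR_fact_lt_0. Qed.

(** As (j + 1) H_(j+1) - j H_j = 1 + H_j, consecutive terms have ratio 2 X exp (2 beta (1 + H_j)) /
    (j + 1), of order (j + 1)^(2 beta - 1). It tends to 0 because beta < 1/2. *)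
Lemma maj_summable (beta b X : R) : 0 < beta < / 2 -> 0 <= b -> 0 <= X ->
  ex_series (fun j => X ^ j / INR (Factorial.fact j) * maj beta b j).
Proof.
  intros hbeta hb hX0.
  (* The ratio test wants nonzero terms; X = 0 is covered by comparison with X + 1. *)
  enough (h : forall X, 0 < X -> ex_series (fun j => X ^ j / INR (Factorial.fact j) * maj beta b j)).
  { apply (@ex_series_le R_AbsRing R_CompleteNormedModule _
      (fun j => (X + 1) ^ j / INR (Factorial.fact j) * maj beta b j)); [|apply h; lra].
    intros j. change (norm ?z) with (Rabs z).
    pose proof (maj_ge_1 beta b j ltac:(lra) hb).
    pose proof (fact_inv_pos j). pose proof (pow_le X j hX0).
    rewrite Rabs_pos_eq.
    2:{ apply Rmult_le_pos; [apply Rmult_le_pos; lra|lra]. }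
    apply Rmult_le_compat_r; [lra|]. apply Rmult_le_compat_r; [lra|]. apply pow_incr; lra. }
  clear X hX0. intros X hX.
  apply (ex_series_ext (fun j => Rabs (X ^ j / INR (Factorial.fact j) * maj beta b j))).
  { intros j. apply Rabs_pos_eq. pose proof (maj_ge_1 beta b j ltac:(lra) hb).
    pose proof (fact_inv_pos j). pose proof (pow_lt X j hX).
    apply Rmult_le_pos; [apply Rmult_le_pos; lra|lra]. }
  apply (ex_series_DAlembert _ 0); [lra| |].
  { intros j. pose proof (maj_ge_1 beta b j ltac:(lra) hb).
    pose proof (fact_inv_pos j). pose proof (pow_lt X j hX).
    apply Rgt_not_eq. apply Rmult_lt_0_compat; [apply Rmult_lt_0_compat; auto|lra]. }
  apply (is_lim_seq_ext (fun j => 2 * X / INR (S j) * exp (2 * beta * (1 + harm j)))).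
  { intros j. pose proof (INR_S_pos j). pose proof (INR_fact_lt_0 j). pose proof (pow_lt X j hX).
    replace (X ^ S j / INR (Factorial.fact (S j)) * maj beta b (S j)
             / (X ^ j / INR (Factorial.fact j) * maj beta b j))
      with (2 * X / INR (S j) * exp (2 * beta * (1 + harm j))).
    - rewrite Rabs_pos_eq; auto.
      apply Rmult_le_pos; [|apply Rlt_le, exp_pos].
      apply Rmult_le_pos; [lra|]. apply Rlt_le, Rinv_0_lt_compat; auto.
    - unfold maj. rewrite fact_simpl, mult_INR, harm_S.
      replace (2 * beta * INR (S j) * (harm j + / INR (S j)))
        with (2 * beta * (1 + harm j) + 2 * beta * INR j * harm j)
        by (rewrite S_INR in *; field; lra).
      rewrite exp_plus. pose proof (exp_pos (2 * beta * INR j * harm j)). pose proof (exp_pos b).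
      pose proof (pow_lt 2 j ltac:(lra)). simpl pow.
      field. repeat split; lra. }
  apply (is_lim_seq_le_le (fun _ => 0) _
    (fun j => 2 * X * exp (4 * beta) * Rpower (INR (S j)) (- (1 - 2 * beta)))).
  - intros j. pose proof (INR_S_pos j). split.
    + apply Rmult_le_pos; [|apply Rlt_le, exp_pos].
      apply Rmult_le_pos; [lra|]. apply Rlt_le, Rinv_0_lt_compat; auto.
    + replace (2 * X * exp (4 * beta) * Rpower (INR (S j)) (- (1 - 2 * beta)))
        with (2 * X / INR (S j) * (exp (4 * beta) * Rpower (INR (S j)) (2 * beta))).
      2:{ replace (- (1 - 2 * beta)) with (2 * beta + - (1)) by ring.
          rewrite Rpower_plus, Rpower_Ropp, Rpower_1 by auto. field; lra. }
      apply Rmult_le_compat_l.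
      { apply Rmult_le_pos; [lra|]. apply Rlt_le, Rinv_0_lt_compat; auto. }
      unfold Rpower. rewrite <- exp_plus. apply exp_le_le.
      pose proof (harm_le_ln j). nra.
  - apply is_lim_seq_const.
  - rewrite <- (Rmult_0_r (2 * X * exp (4 * beta))).
    apply (is_lim_seq_scal_l _ _ 0). apply Rpower_neg_lim_0. lra.
Qed.

(** * Discrete approximation of the Wright function *)

Lemma rgamma_maj (beta b : R) (j : nat) : 0 < beta <= 1 -> 0 <= b ->
  Rabs (rgamma (INR j * - beta + b)) <= maj beta b j.
Proof.
  intros hbeta hb.
  apply (is_lim_seq_le (fun m => Rabs (rho (INR j * - beta + b) (S m)))
           (fun _ => maj beta b j)
           (Rabs (rgamma (INR j * - beta + b))) (maj beta b j)).
  - intros m; apply rho_maj; auto.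
  - apply (is_lim_seq_abs _ (rgamma _)), rho_cvg.
  - apply is_lim_seq_const.
Qed.

Lemma term_bound (x X a M : R) (j : nat) : Rabs x <= X -> Rabs a <= M ->
  Rabs (x ^ j / INR (Factorial.fact j) * a) <= X ^ j / INR (Factorial.fact j) * M.
Proof.
  intros hx ha. pose proof (fact_inv_pos j).
  unfold Rdiv. rewrite !Rabs_mult, (Rabs_pos_eq (/ _)), <- RPow_abs by lra.
  pose proof (Rabs_pos x). pose proof (pow_le (Rabs x) j ltac:(lra)).
  apply Rmult_le_compat; auto using Rabs_pos.
  - apply Rmult_le_pos; lra.
  - apply Rmult_le_compat_r; [lra|]. apply pow_incr; lra.
Qed.

Lemma ex_series_maj_abs (beta b z : R) (a : nat -> R) : 0 < beta < / 2 -> 0 <= b ->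
  (forall j, Rabs (a j) <= maj beta b j) ->
  ex_series (fun j => Rabs (z ^ j / INR (Factorial.fact j) * a j)).
Proof.
  intros hbeta hb ha.
  apply (@ex_series_le R_AbsRing R_CompleteNormedModule _
           (fun j => Rabs z ^ j / INR (Factorial.fact j) * maj beta b j)).
  - intros j. change (norm ?z) with (Rabs z). rewrite Rabs_Rabsolu. apply term_bound; auto; lra.
  - apply maj_summable; auto using Rabs_pos.
Qed.

Lemma ex_series_maj (beta b z : R) (a : nat -> R) : 0 < beta < / 2 -> 0 <= b ->
  (forall j, Rabs (a j) <= maj beta b j) ->
  ex_series (fun j => z ^ j / INR (Factorial.fact j) * a j).
Proof. intros; apply ex_series_Rabs, (ex_series_maj_abs beta b); auto. Qed.

Lemma ex_series_Wright (beta b z : R) : 0 < beta < / 2 -> 0 <= b ->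
  ex_series (fun n => z ^ n / INR (Factorial.fact n) * rgamma (INR n * - beta + b)).
Proof. intros; apply (ex_series_maj beta b); auto. intros; apply rgamma_maj; lra. Qed.

Lemma ex_series_Rmult_l (c : R) (a : nat -> R) : ex_series a -> ex_series (fun n => c * a n).
Proof. exact (ex_series_scal_l c a). Qed.

(** The bridge of the proof: termwise close to the Wright function, and by [wapprox_gcoef] a
    rescaled coefficient of (1 - z)^(-b) exp(-y (1 - z)^beta). *)
Definition wapprox (beta b : R) (m : nat) (x : R) : R :=
  Series (fun j => (- x) ^ j / INR (Factorial.fact j) * rho (INR j * - beta + b) m).

Lemma ex_series_wapprox (beta b x : R) (m : nat) : 0 < beta < / 2 -> 0 <= b ->
  ex_series (fun j => (- x) ^ j / INR (Factorial.fact j) * rho (INR j * - beta + b) (S m)).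
Proof. intros; apply (ex_series_maj beta b); auto. intros; apply rho_maj; lra. Qed.

(** The modulus [d] is the sum of [tannery] at X. Uniformity matters because the argument x
    tau^(-beta) moves with tau under the integral. *)
Lemma wapprox_cvg (beta b X : R) : 0 < beta < / 2 -> 0 <= b -> 0 <= X ->
  exists d : nat -> R, is_lim_seq d 0 /\
    forall m x, Rabs x <= X ->
      Rabs (wapprox beta b (S m) x - Wright (- x) (- beta) b) <= d m.
Proof.
  intros hbeta hb hX.
  set (w := fun j => X ^ j / INR (Factorial.fact j)).
  assert (hw : forall j, 0 <= w j).
  { intros j. apply Rmult_le_pos; [apply pow_le; auto|apply Rlt_le, fact_inv_pos]. }
  set (r := fun m j => rho (INR j * - beta + b) (S m)).
  set (g := fun j => rgamma (INR j * - beta + b)).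
  exists (fun m => Series (fun j => Rabs (w j * r m j - w j * g j))). split.
  - apply (tannery _ _ (fun j => w j * maj beta b j)).
    + intros m j. rewrite Rabs_mult, (Rabs_pos_eq (w j)) by auto.
      apply Rmult_le_compat_l; auto. apply rho_maj; lra.
    + apply maj_summable; auto.
    + intros j. apply (is_lim_seq_scal_l _ (w j) (g j)). apply rho_cvg.
  - intros m x hx. unfold wapprox, Wright.
    rewrite <- Series_minus by (auto using ex_series_wapprox, ex_series_Wright).
    assert (hle : forall j,
      0 <= Rabs ((- x) ^ j / INR (Factorial.fact j) * rho (INR j * - beta + b) (S m) -
           (- x) ^ j / INR (Factorial.fact j) * rgamma (INR j * - beta + b))
      <= Rabs (w j * r m j - w j * g j)).
    { intros j. split; [apply Rabs_pos|].
      rewrite <- !Rmult_minus_distr_l, Rabs_mult, (Rabs_mult (w j)).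
      apply Rmult_le_compat_r; [apply Rabs_pos|].
      rewrite (Rabs_pos_eq (w j)) by auto.
      rewrite <- (Rmult_1_r (_ / _)), <- (Rmult_1_r (w j)).
      apply term_bound; [rewrite Rabs_Ropp; auto|rewrite Rabs_R1; lra]. }
    assert (hex : ex_series (fun j => Rabs (w j * r m j - w j * g j))).
    { apply (@ex_series_le R_AbsRing R_CompleteNormedModule _
               (fun j => w j * maj beta b j + w j * maj beta b j)).
      - intros j. change (norm ?z) with (Rabs z). rewrite Rabs_Rabsolu.
        unfold Rminus. eapply Rle_trans; [apply Rabs_triang|].
        rewrite Rabs_Ropp, !Rabs_mult, (Rabs_pos_eq (w j)) by auto.
        apply Rplus_le_compat; apply Rmult_le_compat_l; auto;
          [apply rho_maj|apply rgamma_maj]; lra.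
      - apply (ex_series_plus (fun j => w j * maj beta b j) (fun j => w j * maj beta b j));
          apply maj_summable; auto. }
    eapply Rle_trans; [apply Series_Rabs|apply Series_le; auto].
    apply (@ex_series_le R_AbsRing R_CompleteNormedModule _ (fun j => Rabs (w j * r m j - w j * g j))); auto.
    intros j. change (norm ?z) with (Rabs z). rewrite Rabs_Rabsolu. apply hle.
Qed.

Lemma wapprox_bound (beta b X : R) : 0 < beta < / 2 -> 0 <= b ->
  exists C, 0 <= C /\ forall m x, Rabs x <= X -> Rabs (wapprox beta b (S m) x) <= C.
Proof.
  intros hbeta hb.
  destruct (Rle_lt_dec 0 X) as [hX|hX].
  2:{ exists 0; split; [lra|]. intros m x hx. pose proof (Rabs_pos x). lra. }
  exists (Series (fun j => X ^ j / INR (Factorial.fact j) * maj beta b j)).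
  assert (key : forall m x, Rabs x <= X -> Rabs (wapprox beta b (S m) x) <=
     Series (fun j => X ^ j / INR (Factorial.fact j) * maj beta b j)).
  { intros m x hx. unfold wapprox.
    eapply Rle_trans.
    - apply Series_Rabs, (ex_series_maj_abs beta b); auto. intros; apply rho_maj; lra.
    - apply Series_le; [|apply maj_summable; auto].
      intros j; split; [apply Rabs_pos|]. apply term_bound; [rewrite Rabs_Ropp; auto|].
      apply rho_maj; lra. }
  split; auto.
  eapply Rle_trans; [apply Rabs_pos|]. apply (key 0%nat 0). rewrite Rabs_R0; auto.
Qed.

(* The coefficient of z^m in (1 - z)^(-b) exp(-y (1 - z)^beta). *)
Definition gcoef (beta b y : R) (m : nat) : R :=
  Series (fun j => (- y) ^ j / INR (Factorial.fact j) * rise (INR j * - beta + b) m).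

(** The j-dependent part of the normalisation of [rho] is a j-th power and goes into the argument;
    hence the scaling y = x n^beta. *)
Lemma gcoef_term (beta b y : R) (k j : nat) :
  (- y) ^ j / INR (Factorial.fact j) * rise (INR j * - beta + b) (S k) =
  Rpower (INR (S k)) (b - 1) *
  ((- (y * Rpower (INR (S k)) (- beta))) ^ j / INR (Factorial.fact j)
   * rho (INR j * - beta + b) (S k)).
Proof.
  rewrite rise_rho. pose proof (INR_S_pos k).
  replace (INR j * - beta + b - 1) with (b - 1 + - beta * INR j) by ring.
  rewrite Rpower_plus, <- Rpower_mult, Rpower_pow by apply Rpower_pos.
  rewrite Ropp_mult_distr_l, Rpow_mult_distr.
  field. apply INR_fact_neq_0.
Qed.

Lemma ex_series_gcoef (beta b y : R) (m : nat) : 0 < beta < / 2 -> 0 <= b ->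
  ex_series (fun j => (- y) ^ j / INR (Factorial.fact j) * rise (INR j * - beta + b) m).
Proof.
  intros hbeta hb. destruct m as [|k].
  (* Index 0 is outside the range of the bounds on [rho], but there every [rise] is 1, below the
     majorant. *)
  - apply (ex_series_maj beta b); auto. intros j. simpl. rewrite Rabs_R1. apply maj_ge_1; lra.
  - eapply ex_series_ext; [intros j; symmetry; apply gcoef_term|].
    apply ex_series_Rmult_l, ex_series_wapprox; auto.
Qed.

Lemma gcoef_wapprox (beta b y : R) (k : nat) :
  gcoef beta b y (S k) =
  Rpower (INR (S k)) (b - 1) * wapprox beta b (S k) (y * Rpower (INR (S k)) (- beta)).
Proof.
  unfold gcoef, wapprox. rewrite <- Series_scal_l. apply Series_ext. intros j. apply gcoef_term.
Qed.

Lemma Series_sum_f_R0 (c : nat -> R) (u : nat -> nat -> R) (n : nat) :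
  (forall k, ex_series (u k)) ->
  ex_series (fun j => sum_f_R0 (fun k => c k * u k j) n) /\
  sum_f_R0 (fun k => c k * Series (u k)) n = Series (fun j => sum_f_R0 (fun k => c k * u k j) n).
Proof.
  intros hu.
  assert (hc : forall k, ex_series (fun j => c k * u k j)) by (intros; apply ex_series_Rmult_l; auto).
  induction n as [|n [IH1 IH2]]; simpl.
  - split; auto. symmetry; apply Series_scal_l.
  - split.
    + apply (ex_series_plus (fun j => sum_f_R0 (fun k => c k * u k j) n)
               (fun j => c (S n) * u (S n) j)); auto.
    + rewrite IH2, Series_plus, Series_scal_l; auto.
Qed.

(** Vandermonde for each j, after exchanging the finite sum with the series. The value p = 1 gives
    partial sums of coefficients, which [left_tail] exploits. *)
Lemma gcoef_conv (beta b p y : R) (n : nat) : 0 < beta < / 2 -> 0 <= b ->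
  sum_f_R0 (fun k => rise p (n - k) * gcoef beta b y k) n = gcoef beta (b + p) y n.
Proof.
  intros hbeta hb. unfold gcoef.
  rewrite (proj2 (Series_sum_f_R0 (fun k => rise p (n - k)) _ n
                    (fun k => ex_series_gcoef beta b y k hbeta hb))).
  apply Series_ext. intros j.
  rewrite (sum_eq _ (fun k => rise p (n - k) * rise (INR j * - beta + b) k
                              * ((- y) ^ j / INR (Factorial.fact j)))) by (intros; ring).
  rewrite <- scal_sum, vandermonde. do 2 f_equal. ring.
Qed.

Lemma gcoef_0 (beta b y : R) : gcoef beta b y 0 = exp (- y).
Proof.
  unfold gcoef. rewrite exp_Reals. unfold PSeries. apply Series_ext. intros j. simpl. field.
  apply INR_fact_neq_0.
Qed.

(** Coefficient form of d/dz exp(-y (1 - z)^beta) = y beta (1 - z)^(beta - 1) exp(-y (1 -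
    z)^beta). *)
Lemma gcoef_step (beta y : R) (m : nat) : 0 < beta < / 2 ->
  INR (S m) * gcoef beta 0 y (S m) = y * beta * gcoef beta (1 - beta) y m.
Proof.
  intros hbeta. unfold gcoef. rewrite Series_incr_1 by (apply ex_series_gcoef; lra).
  simpl (INR 0). rewrite Rmult_0_l, Rplus_0_l, rise_0, Rmult_0_r, Rplus_0_l.
  rewrite <- !Series_scal_l. apply Series_ext. intros j.
  rewrite Rplus_0_r, <- Rmult_assoc, (Rmult_comm (INR (S m))), Rmult_assoc, rise_step, <- rise_shift.
  replace (INR (S j) * - beta + 1) with (INR j * - beta + (1 - beta)) by (rewrite S_INR; ring).
  rewrite fact_simpl, mult_INR. simpl pow. pose proof (INR_S_pos j).
  field. split; [apply INR_fact_neq_0|lra].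
Qed.

Lemma sum_f_R0_nonneg (a : nat -> R) (n : nat) :
  (forall k, (k <= n)%nat -> 0 <= a k) -> 0 <= sum_f_R0 a n.
Proof.
  induction n as [|n IH]; intros h; simpl; [apply h; lia|].
  apply Rplus_le_le_0_compat; [apply IH; intros; apply h; lia|apply h; lia].
Qed.

(* By [gcoef_step] and [gcoef_conv] the coefficients of exp(-y (1 - z)^beta) satisfy a
   recursion with nonnegative weights. *)
Lemma gcoef_nonneg (beta b y : R) (m : nat) : 0 < beta < / 2 -> 0 <= b -> 0 <= y ->
  0 <= gcoef beta b y m.
Proof.
  intros hbeta hb hy.
  assert (mono : forall b n, 0 <= b -> (forall k, (k <= n)%nat -> 0 <= gcoef beta 0 y k) ->
                 0 <= gcoef beta b y n).
  { intros b' n hb' h. rewrite <- (Rplus_0_l b'), <- gcoef_conv by (auto; lra).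
    apply sum_f_R0_nonneg. intros k hk.
    apply Rmult_le_pos; [apply rise_nonneg; auto|auto]. }
  assert (h0 : forall n k, (k <= n)%nat -> 0 <= gcoef beta 0 y k).
  { induction n as [|n IH]; intros k hk.
    - replace k with 0%nat by lia. rewrite gcoef_0. apply Rlt_le, exp_pos.
    - destruct (Nat.eq_dec k (S n)) as [ ->|]; [|apply IH; lia].
      apply (Rmult_le_reg_l (INR (S n))); [apply INR_S_pos|].
      rewrite gcoef_step, Rmult_0_r by auto.
      apply Rmult_le_pos; [apply Rmult_le_pos; lra|]. apply mono; [lra|auto]. }
  apply mono; auto. apply h0.
Qed.

(** * Positivity and monotonicity of the Wright function *)

Lemma wapprox_gcoef (beta b x : R) (k : nat) :
  wapprox beta b (S k) x =
  Rpower (INR (S k)) (1 - b) * gcoef beta b (x * Rpower (INR (S k)) beta) (S k).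
Proof.
  rewrite gcoef_wapprox, <- Rmult_assoc, <- Rpower_plus, Rmult_assoc, <- Rpower_plus.
  rewrite Rplus_opp_r. replace (1 - b + (b - 1)) with 0 by ring.
  rewrite Rpower_O by apply INR_S_pos. rewrite Rmult_1_l, Rmult_1_r. reflexivity.
Qed.

Lemma wapprox_nonneg (beta b x : R) (k : nat) : 0 < beta < / 2 -> 0 <= b -> 0 <= x ->
  0 <= wapprox beta b (S k) x.
Proof.
  intros. rewrite wapprox_gcoef. apply Rmult_le_pos; [apply Rlt_le, Rpower_pos|].
  apply gcoef_nonneg; auto. apply Rmult_le_pos; [auto|apply Rlt_le, Rpower_pos].
Qed.

Lemma wapprox_lim (beta b x : R) : 0 < beta < / 2 -> 0 <= b ->
  is_lim_seq (fun m => wapprox beta b (S m) x) (Wright (- x) (- beta) b).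
Proof.
  intros hbeta hb.
  destruct (wapprox_cvg beta b (Rabs x) hbeta hb (Rabs_pos x)) as [d [hd h]].
  apply (is_lim_seq_le_le (fun m => Wright (- x) (- beta) b - d m) _
           (fun m => Wright (- x) (- beta) b + d m)).
  - intros m. specialize (h m x (Rle_refl _)). apply Rabs_le_between in h. lra.
  - rewrite <- (Rminus_0_r (Wright (- x) (- beta) b)) at 1.
    apply is_lim_seq_minus'; [apply is_lim_seq_const|auto].
  - rewrite <- (Rplus_0_r (Wright (- x) (- beta) b)) at 1.
    apply is_lim_seq_plus'; [apply is_lim_seq_const|auto].
Qed.

Lemma Wright_nonneg (beta b x : R) : 0 < beta < / 2 -> 0 <= b -> 0 <= x ->
  0 <= Wright (- x) (- beta) b.
Proof.
  intros. apply (is_lim_seq_le (fun _ => 0) (fun m => wapprox beta b (S m) x)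
                   0 (Wright (- x) (- beta) b)).
  - intros; apply wapprox_nonneg; auto.
  - apply is_lim_seq_const.
  - apply wapprox_lim; auto.
Qed.

(** * Derivative, recurrence and decay of the Wright function *)

Lemma Wright_PSeries (z a b : R) :
  Wright z a b = PSeries (fun n => rgamma (INR n * a + b) / INR (Factorial.fact n)) z.
Proof.
  unfold Wright, PSeries. apply Series_ext. intros n. field. apply INR_fact_neq_0.
Qed.

Lemma Wright_CV_radius (beta b : R) : 0 < beta < / 2 -> 0 <= b ->
  CV_radius (fun n => rgamma (INR n * - beta + b) / INR (Factorial.fact n)) = p_infty.
Proof.
  intros hbeta hb.
  set (a := fun n => _).
  assert (h : forall r, Rbar_le (Finite r) (CV_radius a)).
  { intros r. apply (proj1 (CV_radius_bounded a)).
    assert (hex : ex_series (fun n => a n * r ^ n)).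
    { eapply ex_series_ext; [|apply (ex_series_Wright beta b r); auto].
      intros n. unfold a. simpl. field. apply INR_fact_neq_0. }
    apply ex_series_lim_0 in hex.
    destruct (filterlim_bounded (fun n => a n * r ^ n)) as [M hM]; [exists 0; exact hex|].
    exists M. exact hM. }
  destruct (CV_radius a) as [c| |]; auto.
  - specialize (h (c + 1)). simpl in h. lra.
  - specialize (h 0). contradiction.
Qed.

Lemma is_derive_Wright (beta b z : R) : 0 < beta < / 2 -> 0 <= b ->
  is_derive (fun z => Wright z (- beta) b) z (Wright z (- beta) (b - beta)).
Proof.
  intros hbeta hb.
  apply (is_derive_ext (PSeries (fun n => rgamma (INR n * - beta + b) / INR (Factorial.fact n)))).
  { intros t. symmetry; apply Wright_PSeries. }
  rewrite Wright_PSeries.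
  rewrite (PSeries_ext _ (PS_derive (fun n => rgamma (INR n * - beta + b) / INR (Factorial.fact n)))).
  - apply is_derive_PSeries. rewrite Wright_CV_radius; simpl; auto.
  - intros n. unfold PS_derive. pose proof (INR_S_pos n).
    replace (INR (S n) * - beta + b) with (INR n * - beta + (b - beta)) by (rewrite S_INR; ring).
    rewrite fact_simpl, mult_INR. field. split; [apply INR_fact_neq_0|lra].
Qed.

Lemma Wright_0 (a b : R) : Wright 0 a b = rgamma b.
Proof.
  rewrite Wright_PSeries, PSeries_0. simpl. rewrite Rmult_0_l, Rplus_0_l. field.
Qed.

(** In 1 / Gamma(c) = c / Gamma(c + 1) with c = b - beta n, the part b gives the last term, and the
    part -beta n cancels against n! and shifts the index. Used at b = beta for the decay and at b =
    0 for the Mainardi function. *)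
Lemma Wright_rec (beta b z : R) : 0 < beta < / 2 -> 0 <= b ->
  - beta * z * Wright z (- beta) (b + 1 - beta) =
  Wright z (- beta) b - b * Wright z (- beta) (b + 1).
Proof.
  intros hbeta hb.
  pose proof (ex_series_Wright beta b z hbeta hb) as h1.
  pose proof (ex_series_Wright beta (b + 1) z hbeta ltac:(lra)) as h2.
  unfold Wright. rewrite <- (Series_scal_l b), <- Series_minus by
    (auto; apply ex_series_Rmult_l; auto).
  rewrite (Series_incr_1 (fun n => _ - _)).
  2:{ apply (ex_series_minus _ _ h1 (ex_series_Rmult_l b _ h2)). }
  rewrite <- Series_scal_l. simpl (INR 0). rewrite Rmult_0_l, !Rplus_0_l, (rgamma_rec b).
  match goal with |- _ = ?X + _ => replace X with 0 by (simpl; field) end.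
  rewrite Rplus_0_l. apply Series_ext. intros n.
  rewrite (rgamma_rec (INR (S n) * - beta + b)).
  replace (INR (S n) * - beta + (b + 1)) with (INR n * - beta + (b + 1 - beta))
    by (rewrite S_INR; ring).
  replace (INR (S n) * - beta + b + 1) with (INR n * - beta + (b + 1 - beta))
    by (rewrite S_INR; ring).
  rewrite fact_simpl, mult_INR. simpl pow. pose proof (INR_S_pos n).
  field. split; [apply INR_fact_neq_0|lra].
Qed.

Lemma is_derive_Wright_opp (beta b x : R) : 0 < beta < / 2 -> 0 <= b ->
  is_derive (fun x => Wright (- x) (- beta) b) x (- Wright (- x) (- beta) (b - beta)).
Proof.
  intros hbeta hb.
  replace (- Wright (- x) (- beta) (b - beta)) with (-1 * Wright (- x) (- beta) (b - beta)) by ring.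
  apply (is_derive_comp (fun z => Wright z (- beta) b) Ropp x (Wright (- x) (- beta) (b - beta)) (-1)).
  - apply is_derive_Wright; auto.
  - auto_derive; auto.
Qed.

Lemma continuous_Wright_opp (beta b x : R) : 0 < beta < / 2 -> 0 <= b ->
  continuous (fun x => Wright (- x) (- beta) b) x.
Proof.
  intros. apply (ex_derive_continuous (fun x => Wright (- x) (- beta) b)).
  eexists. apply is_derive_Wright_opp; auto.
Qed.

Lemma Wright_MVT (beta b x y : R) : 0 < beta < / 2 -> 0 <= b -> x <= y ->
  exists c, x <= c <= y /\
  Wright (- x) (- beta) b - Wright (- y) (- beta) b = Wright (- c) (- beta) (b - beta) * (y - x).
Proof.
  intros hbeta hb hxy.
  destruct (MVT_gen (fun x => Wright (- x) (- beta) b) x y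
              (fun x => - Wright (- x) (- beta) (b - beta))) as [c [hc h]].
  - intros z _. apply is_derive_Wright_opp; lra.
  - intros z _. apply continuity_pt_filterlim, continuous_Wright_opp; auto.
  - rewrite Rmin_left, Rmax_right in hc by lra. exists c. split; auto. lra.
Qed.

Lemma Wright_decr (beta b x y : R) : 0 < beta < / 2 -> beta <= b -> 0 <= x <= y ->
  Wright (- y) (- beta) b <= Wright (- x) (- beta) b.
Proof.
  intros hbeta hb hxy.
  destruct (Wright_MVT beta b x y) as [c [hc h]]; try lra.
  pose proof (Wright_nonneg beta (b - beta) c hbeta ltac:(lra) ltac:(lra)). nra.
Qed.

(** By [Wright_rec] at b = beta, beta x W(-x; -beta, 1) is W(-x; -beta, beta) minus a nonnegative
    term, and the former is at most its value 1 / Gamma(beta) at 0. This controls the integral near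
    0 when b = 0. *)
Lemma Wright_1_decay (beta x : R) : 0 < beta < / 2 -> 0 < x ->
  Wright (- x) (- beta) 1 <= rgamma beta / (beta * x).
Proof.
  intros hbeta hx.
  pose proof (Wright_rec beta beta (- x) hbeta ltac:(lra)) as h.
  replace (beta + 1 - beta) with 1 in h by ring.
  pose proof (Wright_nonneg beta (beta + 1) x hbeta ltac:(lra) ltac:(lra)).
  pose proof (Wright_decr beta beta 0 x hbeta ltac:(lra) ltac:(lra)) as h2.
  rewrite Ropp_0, Wright_0 in h2.
  assert (0 < beta * x) by nra.
  apply (Rmult_le_reg_l (beta * x)); auto.
  replace (beta * x * (rgamma beta / (beta * x))) with (rgamma beta) by (field; lra).
  nra.
Qed.

Lemma Mainardi_Wright (beta x : R) : Mainardi beta x = Wright (- x) (- beta) (1 - beta).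
Proof. reflexivity. Qed.

Lemma Mainardi_Wright_0 (beta x : R) : 0 < beta < / 2 ->
  beta * x * Mainardi beta x = Wright (- x) (- beta) 0.
Proof.
  intros hbeta. rewrite Mainardi_Wright.
  pose proof (Wright_rec beta 0 (- x) hbeta ltac:(lra)) as h.
  rewrite Rplus_0_l in h.
  lra.
Qed.

(* Near [0] the derivative of [x => 1 - W(-x)] is [M(x)], with [M(0) = 1 / Gamma (1 - beta) > 0]. *)
Lemma Wright_1_lt_1 (beta x : R) : 0 < beta < / 2 -> 0 < x -> Wright (- x) (- beta) 1 < 1.
Proof.
  intros hbeta hx.
  assert (h0 : Wright (- 0) (- beta) 1 = 1) by (rewrite Ropp_0, Wright_0; apply rgamma_1).
  pose proof (continuous_Wright_opp beta (1 - beta) 0 hbeta ltac:(lra)) as hc.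
  assert (hM : 0 < Wright (- 0) (- beta) (1 - beta)).
  { rewrite Ropp_0, Wright_0. apply rgamma_pos_unit; lra. }
  destruct (hc _ (open_gt 0 _ hM)) as [d hd].
  pose proof (cond_pos d) as hd0.
  set (y := Rmin x (d / 2)).
  assert (hy : 0 < y <= x /\ y <= d / 2).
  { repeat split; [apply Rmin_case; lra|apply Rmin_l|apply Rmin_r]. }
  destruct (Wright_MVT beta 1 0 y) as [c [hcy h]]; try lra.
  assert (0 < Wright (- c) (- beta) (1 - beta)).
  { apply hd. change (Rabs (c - 0) < d). rewrite Rminus_0_r, Rabs_pos_eq; lra. }
  pose proof (Wright_decr beta 1 y x hbeta ltac:(lra) ltac:(lra)). nra.
Qed.

(** * The fractional integral of a Wright function *)

Lemma is_derive_Rpower (t a : R) : 0 < t ->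
  is_derive (fun t => Rpower t a) t (a * Rpower t (a - 1)).
Proof. intros h. apply is_derive_Reals, derivable_pt_lim_power; auto. Qed.

Lemma continuous_Rpower (t a : R) : 0 < t -> continuous (fun t => Rpower t a) t.
Proof.
  intros h. apply (ex_derive_continuous (fun t => Rpower t a)).
  eexists; apply is_derive_Rpower; auto.
Qed.

Lemma Rpower_antitone (u v a : R) : a <= 0 -> 0 < u <= v -> Rpower v a <= Rpower u a.
Proof.
  intros ha huv. unfold Rpower. apply exp_le_le.
  assert (ln u <= ln v) by (apply ln_le; lra). nra.
Qed.

(** The heights [c i] need not be values of f: the discrete kernel only approximates f at the nodes,
    and [eps] absorbs both errors. *)
Lemma riemann_sum_close (f : R -> R) (c : nat -> R) (a h eps : R) (m : nat) : 0 <= h ->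
  (forall t, a <= t <= a + INR (S m) * h -> continuous f t) ->
  (forall i t, (i <= m)%nat -> a + INR i * h <= t <= a + INR (S i) * h ->
     Rabs (f t - c i) <= eps) ->
  Rabs (RInt f a (a + INR (S m) * h) - h * sum_f_R0 c m) <= INR (S m) * h * eps.
Proof.
  intros hh. revert c a.
  assert (step : forall c a, (forall t, a <= t <= a + h -> continuous f t) ->
    (forall t, a <= t <= a + h -> Rabs (f t - c) <= eps) ->
    Rabs (RInt f a (a + h) - h * c) <= h * eps).
  { intros c a hf hc.
    assert (hex : ex_RInt f a (a + h)).
    { apply (ex_RInt_continuous f). intros z hz. rewrite Rmin_left, Rmax_right in hz by lra. auto. }
    replace (h * c) with (RInt (fun _ => c) a (a + h)).
    2:{ rewrite RInt_const. change ((a + h - a) * c = h * c). ring. }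
    rewrite <- (RInt_minus f (fun _ => c)); auto using ex_RInt_const.
    replace (h * eps) with ((a + h - a) * eps) by ring.
    apply abs_RInt_le_const; auto; [lra|].
    apply (ex_RInt_minus f (fun _ => c)); auto using ex_RInt_const. }
  induction m as [|m IH]; intros c a hf hc.
  - simpl INR in *. simpl sum_f_R0. rewrite !Rmult_1_l in *. apply step; auto.
    intros t ht. apply (hc 0%nat); [lia|]. simpl. lra.
  - pose proof (pos_INR (S m)) as hm.
    rewrite tech5.
    assert (e : a + INR (S (S m)) * h = a + INR (S m) * h + h) by (rewrite (S_INR (S m)); ring).
    rewrite e in *.
    assert (0 <= INR (S m) * h) by (apply Rmult_le_pos; auto).
    assert (h1 : ex_RInt f a (a + INR (S m) * h)).
    { apply (ex_RInt_continuous f). intros z hz. rewrite Rmin_left, Rmax_right in hz by lra.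
      apply hf; lra. }
    assert (h2 : ex_RInt f (a + INR (S m) * h) (a + INR (S m) * h + h)).
    { apply (ex_RInt_continuous f). intros z hz. rewrite Rmin_left, Rmax_right in hz by lra.
      apply hf; lra. }
    rewrite <- (RInt_Chasles f _ _ _ h1 h2).
    change (plus ?u ?v) with (u + v).
    assert (i1 : Rabs (RInt f a (a + INR (S m) * h) - h * sum_f_R0 c m) <= INR (S m) * h * eps).
    { apply IH; [intros; apply hf; lra|]. intros i t hi ht. apply hc; auto. }
    assert (i2 : Rabs (RInt f (a + INR (S m) * h) (a + INR (S m) * h + h) - h * c (S m)) <= h * eps).
    { apply step; [intros; apply hf; lra|]. intros t ht. apply hc; [lia|]. rewrite <- e in ht; auto. }
    rewrite (S_INR (S m)).
    replace ((INR (S m) + 1) * h * eps) with (INR (S m) * h * eps + h * eps) by ring.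
    eapply Rle_trans; [|apply Rplus_le_compat; [apply i1|apply i2]].
    eapply Rle_trans; [|apply Rabs_triang]. apply Req_le; f_equal; ring.
Qed.

(** With nodes k / (q N) this cuts [0, 1] at 1 / q and 1 - 1 / q; the last block has N + 1 terms. As
    3 <= q, the middle block is nonempty and its truncated [- 1] is a true one. *)
Lemma sum_split3 (t : nat -> R) (q N : nat) : (3 <= q)%nat -> (1 <= N)%nat ->
  sum_f_R0 t (q * N) = sum_f_R0 t (N - 1)
    + sum_f_R0 (fun i => t (N + i)%nat) ((q - 2) * N - 1)
    + sum_f_R0 (fun i => t (q * N - N + i)%nat) N.
Proof.
  intros hq hN.
  destruct q as [|[|[|q]]]; try lia.
  rewrite (tech2 t (N - 1)) by nia. rewrite Rplus_assoc. f_equal.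
  replace (S (N - 1)) with N by lia.
  rewrite (tech2 _ ((S (S (S q)) - 2) * N - 1)) by nia. f_equal.
  replace (S (S (S q)) * N - N - S ((S (S (S q)) - 2) * N - 1))%nat with N by nia.
  apply sum_eq. intros i _. f_equal. nia.
Qed.

Lemma rho_bound_pos (p : R) (m : nat) : 0 <= p -> Rabs (rho p (S m)) <= p * exp p.
Proof.
  intros hp. pose proof (rho_bound p 0 0 m hp) as h. simpl INR in h.
  replace (p - 0) with p in h by ring. replace (p + 2 * 0 * harm 0) with p in h by ring.
  rewrite Rplus_0_r in h. apply h. lra.
Qed.

(** For k < N one has q N - k >= q N / 2, which bounds the weight [rise p] by [K]; the nonnegative
    coefficients that remain sum to at most their convolution with p = 1, the coefficient of index N
    for b + 1. *)
Lemma left_tail (beta b p x : R) (q N : nat) : 0 < beta < / 2 -> 0 <= b -> 0 < p <= 1 -> 0 <= x ->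
  (3 <= q)%nat -> (1 <= N)%nat ->
  Rpower (INR (q * N)) (1 - b - p) *
  sum_f_R0 (fun k => rise p (q * N - k) * gcoef beta b (x * Rpower (INR (q * N)) beta) k) (N - 1)
  <= p * exp p * Rpower (/ 2) (p - 1) *
     (Rpower (INR q) (- b) * wapprox beta (b + 1) N (x * Rpower (INR q) beta)).
Proof.
  intros hbeta hb hp hx hq hN.
  assert (hN0 : 0 < INR N) by (apply lt_0_INR; lia).
  assert (hq0 : 0 < INR q) by (apply lt_0_INR; lia).
  assert (hn : INR (q * N) = INR q * INR N) by apply mult_INR.
  assert (hn0 : 0 < INR (q * N)) by (rewrite hn; nra).
  set (n := (q * N)%nat) in *. set (y := x * Rpower (INR n) beta).
  assert (hy : 0 <= y) by (apply Rmult_le_pos; [auto|apply Rlt_le, Rpower_pos]).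
  assert (hg : forall k, 0 <= gcoef beta b y k) by (intros; apply gcoef_nonneg; auto).
  set (K := p * exp p * Rpower (/ 2 * INR n) (p - 1)).
  assert (hr : forall k, (k <= N - 1)%nat -> rise p (n - k) <= K).
  { intros k hk. rewrite rise_rho. unfold K. rewrite Rmult_comm.
    assert (hnk : (2 * (n - k) >= n)%nat) by (unfold n; nia).
    apply Rmult_le_compat.
    - apply Rmult_le_pos; [apply rise_nonneg; lra|apply Rlt_le, Rpower_pos].
    - apply Rlt_le, Rpower_pos.
    - replace (n - k)%nat with (S (n - k - 1)) by (unfold n; nia).
      eapply Rle_trans; [apply Rle_abs|apply rho_bound_pos; lra].
    - apply Rpower_antitone; [lra|]. split; [lra|].
      assert (INR n <= INR (2 * (n - k))) by (apply le_INR; lia). rewrite mult_INR in H. simpl INR in H. lra. }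
  assert (hK : 0 <= K).
  { apply Rmult_le_pos; [apply Rmult_le_pos; [lra|apply Rlt_le, exp_pos]|apply Rlt_le, Rpower_pos]. }
  assert (h1 : sum_f_R0 (fun k => rise p (n - k) * gcoef beta b y k) (N - 1)
               <= K * gcoef beta (b + 1) y N).
  { apply Rle_trans with (sum_f_R0 (fun k => K * gcoef beta b y k) (N - 1)).
    - apply sum_Rle. intros k hk. apply Rmult_le_compat_r; auto.
    - rewrite <- gcoef_conv by auto. rewrite scal_sum.
      replace (sum_f_R0 (fun i => rise 1 (N - i) * gcoef beta b y i * K) N)
        with (sum_f_R0 (fun k => K * gcoef beta b y k) N).
      2:{ apply sum_eq. intros i _. rewrite rise_1. ring. }
      replace N with (S (N - 1)) at 2 by lia. rewrite tech5.
      assert (0 <= K * gcoef beta b y (S (N - 1))) by (apply Rmult_le_pos; auto). lra. }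
  eapply Rle_trans; [apply Rmult_le_compat_l; [apply Rlt_le, Rpower_pos|apply h1]|].
  apply Req_le.
  replace N with (S (N - 1)) by lia. rewrite gcoef_wapprox. replace (S (N - 1)) with N by lia.
  replace (y * Rpower (INR N) (- beta)) with (x * Rpower (INR q) beta).
  2:{ unfold y. rewrite hn, <- Rpower_mult_distr, Rpower_Ropp by auto.
      field. apply Rgt_not_eq, Rpower_pos. }
  unfold K. rewrite <- Rpower_mult_distr by lra.
  rewrite hn.
  (* The exponents of N add up to (1 - b - p) + (p - 1) + b = 0, those of q to -b. *)
  replace (Rpower (INR q) (- b)) with
    (Rpower (INR q * INR N) (1 - b - p) * Rpower (INR q * INR N) (p - 1) * Rpower (INR N) (b + 1 - 1)).
  2:{ unfold Rpower. rewrite ln_mult, <- !exp_plus by auto. f_equal. ring. }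
  ring.
Qed.

(** The roles are exchanged: the coefficients are bounded because k >= q N / 2, and the weights sum
    to [rise (p + 1) N] by Vandermonde, of order N^p. *)
Lemma right_tail (beta b p x : R) : 0 < beta < / 2 -> 0 <= b <= 1 -> 0 < p <= 1 -> 0 <= x ->
  exists C, 0 <= C /\ forall q N, (3 <= q)%nat -> (1 <= N)%nat ->
  Rpower (INR (q * N)) (1 - b - p) *
  sum_f_R0 (fun i => rise p (q * N - (q * N - N + i))
                     * gcoef beta b (x * Rpower (INR (q * N)) beta) (q * N - N + i)) N
  <= C * Rpower (INR q) (- p).
Proof.
  intros hbeta hb hp hx.
  (* Since k >= n / 2, the argument x (n / k)^beta stays below x (1/2)^(-beta). *)
  destruct (wapprox_bound beta b (x * Rpower (/ 2) (- beta)) hbeta ltac:(lra)) as [C0 [hC0 hC]].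
  exists (Rpower (/ 2) (b - 1) * C0 * ((p + 1) * exp (p + 1))). split.
  { repeat apply Rmult_le_pos; try apply Rlt_le, Rpower_pos; auto; try lra. apply Rlt_le, exp_pos. }
  intros q N hq hN.
  assert (hN0 : 0 < INR N) by (apply lt_0_INR; lia).
  assert (hq0 : 0 < INR q) by (apply lt_0_INR; lia).
  assert (hn : INR (q * N) = INR q * INR N) by apply mult_INR.
  assert (hn0 : 0 < INR (q * N)) by (rewrite hn; nra).
  set (n := (q * N)%nat) in *. set (y := x * Rpower (INR n) beta).
  set (K := Rpower (/ 2 * INR n) (b - 1) * C0).
  assert (hg : forall i, gcoef beta b y (n - N + i) <= K).
  { intros i. set (k := (n - N + i)%nat).
    assert (hk : (2 * k >= n)%nat) by (unfold k, n; nia).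
    assert (hk2 : / 2 * INR n <= INR k).
    { assert (INR n <= INR (2 * k)) by (apply le_INR; lia). rewrite mult_INR in H. simpl INR in H. lra. }
    assert (hkS : k = S (k - 1)) by (unfold k, n; nia).
    rewrite hkS, gcoef_wapprox. rewrite <- !hkS. unfold K.
    apply Rmult_le_compat.
    - apply Rlt_le, Rpower_pos.
    - rewrite hkS. apply wapprox_nonneg; [auto|lra|].
      repeat apply Rmult_le_pos; auto; apply Rlt_le, Rpower_pos.
    - apply Rpower_antitone; lra.
    - rewrite hkS at 1. eapply Rle_trans; [apply Rle_abs|]. apply hC. unfold y.
      rewrite Rmult_assoc, Rabs_mult, (Rabs_pos_eq x) by auto. apply Rmult_le_compat_l; auto.
      rewrite Rabs_pos_eq by (apply Rmult_le_pos; apply Rlt_le, Rpower_pos).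
      apply Rle_trans with (Rpower (INR n) beta * Rpower (/ 2 * INR n) (- beta)).
      + apply Rmult_le_compat_l; [apply Rlt_le, Rpower_pos|]. apply Rpower_antitone; lra.
      + rewrite <- Rpower_mult_distr, (Rpower_Ropp (INR n)) by lra. apply Req_le.
        field. apply Rgt_not_eq, Rpower_pos. }
  assert (hK : 0 <= K) by (apply Rmult_le_pos; [apply Rlt_le, Rpower_pos|auto]).
  assert (h1 : sum_f_R0 (fun i => rise p (n - (n - N + i)) * gcoef beta b y (n - N + i)) N
               <= K * rise (p + 1) N).
  { rewrite <- vandermonde, scal_sum. apply sum_Rle. intros i hi. rewrite rise_1, Rmult_1_r.
    replace (n - (n - N + i))%nat with (N - i)%nat by (unfold n; nia).
    apply Rmult_le_compat_l; [apply rise_nonneg; lra|auto]. }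
  assert (h2 : rise (p + 1) N <= Rpower (INR N) p * ((p + 1) * exp (p + 1))).
  { rewrite rise_rho. replace (p + 1 - 1) with p by ring.
    apply Rmult_le_compat_l; [apply Rlt_le, Rpower_pos|].
    replace N with (S (N - 1)) by lia.
    eapply Rle_trans; [apply Rle_abs|apply rho_bound_pos; lra]. }
  eapply Rle_trans; [apply Rmult_le_compat_l; [apply Rlt_le, Rpower_pos|apply h1]|].
  eapply Rle_trans.
  { apply Rmult_le_compat_l; [apply Rlt_le, Rpower_pos|].
    apply Rmult_le_compat_l; [auto|apply h2]. }
  apply Req_le. unfold K. rewrite <- Rpower_mult_distr by lra. rewrite hn.
  replace (Rpower (INR q) (- p)) with
    (Rpower (INR q * INR N) (1 - b - p) * Rpower (INR q * INR N) (b - 1) * Rpower (INR N) p).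
  2:{ unfold Rpower. rewrite ln_mult, <- !exp_plus by auto. f_equal. ring. }
  ring.
Qed.

(** Gamma(p) is moved into the integrand, so that the integral over (0, 1) is W(-x; -beta, b + p)
    itself. *)
Definition kern (beta b p x tau : R) : R :=
  rgamma p * (Rpower (1 - tau) (p - 1) * Rpower tau (b - 1)
              * Wright (- (x * Rpower tau (- beta))) (- beta) b).

Lemma continuous_kern (beta b p x tau : R) : 0 < beta < / 2 -> 0 <= b -> 0 < tau < 1 ->
  continuous (kern beta b p x) tau.
Proof.
  intros hbeta hb ht. unfold kern.
  apply (continuous_mult (fun _ => rgamma p)); [apply continuous_const|].
  apply (continuous_mult (fun tau => Rpower (1 - tau) (p - 1) * Rpower tau (b - 1))).
  - apply (continuous_mult (fun tau => Rpower (1 - tau) (p - 1))).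
    + apply (continuous_comp (fun tau => 1 - tau) (fun t => Rpower t (p - 1))).
      * apply (continuous_minus (fun _ => 1) (fun t => t)); [apply continuous_const|apply continuous_id].
      * apply continuous_Rpower; lra.
    + apply continuous_Rpower; lra.
  - apply (continuous_comp (fun tau => x * Rpower tau (- beta)) (fun z => Wright (- z) (- beta) b)).
    + apply (continuous_mult (fun _ => x)); [apply continuous_const|apply continuous_Rpower; lra].
    + apply continuous_Wright_opp; auto.
Qed.

Lemma kern_nonneg (beta b p x tau : R) : 0 < beta < / 2 -> 0 <= b -> 0 < p <= 1 -> 0 <= x ->
  0 <= kern beta b p x tau.
Proof.
  intros hbeta hb hp hx. unfold kern.
  apply Rmult_le_pos; [apply Rlt_le, rgamma_pos_unit; auto|].
  apply Rmult_le_pos; [apply Rmult_le_pos; apply Rlt_le, Rpower_pos|].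
  apply Wright_nonneg; auto. apply Rmult_le_pos; [auto|apply Rlt_le, Rpower_pos].
Qed.

Lemma ex_RInt_kern (beta b p x u v : R) : 0 < beta < / 2 -> 0 <= b -> 0 < u -> u <= v -> v < 1 ->
  ex_RInt (kern beta b p x) u v.
Proof.
  intros. apply (ex_RInt_continuous (kern beta b p x)). intros z hz.
  rewrite Rmin_left, Rmax_right in hz by lra. apply continuous_kern; auto; lra.
Qed.

Lemma RInt_kern_mono (beta b p x u' u v v' : R) :
  0 < beta < / 2 -> 0 <= b -> 0 < p <= 1 -> 0 <= x ->
  0 < u' -> u' <= u -> u <= v -> v <= v' -> v' < 1 ->
  RInt (kern beta b p x) u v <= RInt (kern beta b p x) u' v'.
Proof.
  intros hbeta hb hp hx h1 h2 h3 h4 h5.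
  assert (e : forall s t, 0 < s -> s <= t -> t < 1 -> ex_RInt (kern beta b p x) s t)
    by (intros; apply ex_RInt_kern; auto).
  assert (pos : forall s t, 0 < s -> s <= t -> t < 1 -> 0 <= RInt (kern beta b p x) s t)
    by (intros; apply RInt_ge_0; auto; intros; apply kern_nonneg; auto).
  rewrite <- (RInt_Chasles (kern beta b p x) u' u v'), <- (RInt_Chasles (kern beta b p x) u v v')
    by (apply e; lra).
  change (plus ?r (plus ?s ?t)) with (r + (s + t)).
  pose proof (pos u' u). pose proof (pos v v'). lra.
Qed.

(** The exponents (1 - b - p) + (p - 1) + (b - 1) add up to -1, so the normalisation becomes the
    mesh 1 / (q N) of a Riemann sum. *)
Lemma middle_term (beta b p x : R) (q N i : nat) :
  (3 <= q)%nat -> (1 <= N)%nat -> (i <= (q - 2) * N - 1)%nat ->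
  Rpower (INR (q * N)) (1 - b - p) *
  (rise p (q * N - (N + i)) * gcoef beta b (x * Rpower (INR (q * N)) beta) (N + i)) =
  / INR (q * N) *
  (rho p (q * N - (N + i)) *
   (Rpower (1 - INR (N + i) / INR (q * N)) (p - 1) * Rpower (INR (N + i) / INR (q * N)) (b - 1)
    * wapprox beta b (N + i) (x * Rpower (INR (N + i) / INR (q * N)) (- beta)))).
Proof.
  intros hq hN hi.
  set (n := (q * N)%nat). set (k := (N + i)%nat).
  assert (hkn : (k < n)%nat) by (unfold k, n; nia).
  assert (hk : 0 < INR k) by (apply lt_0_INR; unfold k; lia).
  assert (hnk : 0 < INR (n - k)) by (apply lt_0_INR; lia).
  assert (hn : 0 < INR n) by (apply lt_0_INR; lia).
  assert (e : 1 - INR k / INR n = INR (n - k) / INR n) by (rewrite minus_INR by lia; field; lra).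
  assert (hg : forall y, gcoef beta b y k =
            Rpower (INR k) (b - 1) * wapprox beta b k (y * Rpower (INR k) (- beta))).
  { intros y. replace k with (S (k - 1)) by (unfold k; lia). apply gcoef_wapprox. }
  rewrite e, rise_rho, hg.
  replace (x * Rpower (INR n) beta * Rpower (INR k) (- beta))
    with (x * Rpower (INR k / INR n) (- beta)).
  2:{ unfold Rpower, Rdiv. rewrite ln_mult, ln_Rinv by (auto; apply Rinv_0_lt_compat; auto).
      rewrite Rmult_assoc, <- exp_plus. do 2 f_equal. ring. }
  assert (ep : Rpower (INR n) (1 - b - p) * (Rpower (INR (n - k)) (p - 1) * Rpower (INR k) (b - 1)) =
          / INR n * (Rpower (INR (n - k) / INR n) (p - 1) * Rpower (INR k / INR n) (b - 1))).
  { replace (/ INR n) with (Rpower (INR n) (- (1))) at 1 by (rewrite Rpower_Ropp, Rpower_1; auto).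
    unfold Rpower, Rdiv. rewrite !ln_mult, !ln_Rinv by (auto; apply Rinv_0_lt_compat; auto).
    rewrite <- !exp_plus. f_equal. ring. }
  set (A := wapprox _ _ _ _).
  transitivity (Rpower (INR n) (1 - b - p) * (Rpower (INR (n - k)) (p - 1) * Rpower (INR k) (b - 1))
                * (rho p (n - k) * A)); [ring|].
  rewrite ep. ring.
Qed.

Lemma kern_approx (beta b p x delta eps : R) :
  0 < beta < / 2 -> 0 <= b <= 1 -> 0 < p <= 1 -> 0 <= x -> 0 < delta -> 0 < eps ->
  exists M, forall m k tau, (M <= m)%nat -> (M <= k)%nat -> delta <= tau <= 1 - delta ->
  Rabs (kern beta b p x tau -
        rho p (S m) * (Rpower (1 - tau) (p - 1) * Rpower tau (b - 1)
                       * wapprox beta b (S k) (x * Rpower tau (- beta)))) <= eps.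
Proof.
  intros hbeta hb hp hx hd he.
  set (X := x * Rpower delta (- beta)).
  assert (hX : 0 <= X) by (apply Rmult_le_pos; [auto|apply Rlt_le, Rpower_pos]).
  destruct (wapprox_bound beta b X hbeta ltac:(lra)) as [C [hC0 hC]].
  destruct (wapprox_cvg beta b X hbeta ltac:(lra) hX) as [d [hdl hdb]].
  set (w := Rpower delta (p - 1) * Rpower delta (b - 1)).
  assert (hw : 0 < w) by (apply Rmult_lt_0_compat; apply Rpower_pos).
  pose proof (rgamma_pos_unit p hp) as hg.
  assert (hden : 0 < w * (C + rgamma p)) by (apply Rmult_lt_0_compat; lra).
  (* The errors in W and in 1 / Gamma(p) contribute at most e1 / Gamma(p) and e1 C, both under a
     weight at most [w]. *)
  set (e1 := eps / (w * (C + rgamma p))).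
  assert (he1 : 0 < e1) by (apply Rdiv_lt_0_compat; auto).
  pose proof (rho_cvg p) as hr. apply is_lim_seq_spec in hr. apply is_lim_seq_spec in hdl.
  destruct (hr (mkposreal e1 he1)) as [M1 hM1]. destruct (hdl (mkposreal e1 he1)) as [M2 hM2].
  simpl in hM1, hM2.
  exists (Nat.max M1 M2). intros m k tau hm hk ht.
  specialize (hM1 m ltac:(lia)). specialize (hM2 k ltac:(lia)).
  rewrite Rminus_0_r in hM2.
  unfold kern. set (z := x * Rpower tau (- beta)).
  assert (hz : Rabs z <= X).
  { rewrite Rabs_pos_eq by (apply Rmult_le_pos; [auto|apply Rlt_le, Rpower_pos]).
    apply Rmult_le_compat_l; auto. apply Rpower_antitone; lra. }
  specialize (hC k z hz). specialize (hdb k z hz).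
  set (W := Wright (- z) (- beta) b) in *. set (A := wapprox beta b (S k) z) in *.
  set (r := rho p (S m)) in *. set (g := rgamma p) in *.
  set (v := Rpower (1 - tau) (p - 1) * Rpower tau (b - 1)).
  assert (hv : 0 <= v <= w).
  { split; [apply Rmult_le_pos; apply Rlt_le, Rpower_pos|].
    apply Rmult_le_compat; try apply Rlt_le, Rpower_pos; apply Rpower_antitone; lra. }
  replace (g * (v * W) - r * (v * A)) with (v * (g * (W - A) + (g - r) * A)) by ring.
  rewrite Rabs_mult, (Rabs_pos_eq v) by lra.
  assert (h1 : Rabs (g * (W - A)) <= g * e1).
  { rewrite Rabs_mult, (Rabs_pos_eq g) by lra. apply Rmult_le_compat_l; [lra|].
    rewrite Rabs_minus_sym. pose proof (Rle_abs (d k)). lra. }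
  assert (h2 : Rabs ((g - r) * A) <= e1 * C).
  { rewrite Rabs_mult. apply Rmult_le_compat; auto using Rabs_pos.
    rewrite Rabs_minus_sym. lra. }
  replace eps with (w * (g * e1 + e1 * C)).
  2:{ unfold e1. field. split; lra. }
  apply Rmult_le_compat; try lra; [apply Rabs_pos|].
  eapply Rle_trans; [apply Rabs_triang|]. lra.
Qed.

Lemma middle_lim (beta b p x : R) (q : nat) :
  0 < beta < / 2 -> 0 <= b <= 1 -> 0 < p <= 1 -> 0 <= x -> (3 <= q)%nat ->
  is_lim_seq (fun N => Rpower (INR (q * S N)) (1 - b - p) *
    sum_f_R0 (fun i => rise p (q * S N - (S N + i)) *
       gcoef beta b (x * Rpower (INR (q * S N)) beta) (S N + i)) ((q - 2) * S N - 1))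
   (RInt (kern beta b p x) (/ INR q) (1 - / INR q)).
Proof.
  intros hbeta hb hp hx hq.
  assert (hq3 : 3 <= INR q) by (apply (le_INR 3) in hq; simpl in hq; lra).
  assert (hiq : 0 < / INR q) by (apply Rinv_0_lt_compat; lra).
  assert (hiq3 : / INR q <= / 3) by (apply Rinv_le_contravar; lra).
  apply is_lim_seq_spec. intros eps. pose proof (cond_pos eps) as heps.
  (* One quarter of [eps] for the discrete kernel, one for uniform continuity; the interval has
     length at most 1, so eps / 2 remains as margin. *)
  destruct (kern_approx beta b p x (/ INR q) (eps / 4) hbeta hb hp hx hiq ltac:(lra)) as [M hM].
  assert (heps4 : 0 < eps / 4) by lra.
  destruct (@Heine_cor2 (kern beta b p x) (/ INR q) (1 - / INR q)) with (eps := mkposreal _ heps4)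
    as [delta hdelta].
  { intros t ht. apply continuity_pt_filterlim, continuous_kern; lra. }
  simpl in hdelta.
  destruct (nfloor_ex (/ delta)) as [M' hM']; [apply Rlt_le, Rinv_0_lt_compat, cond_pos|].
  exists (Nat.max (S M) M'). intros N hN.
  set (n := (q * S N)%nat). set (m := ((q - 2) * S N - 1)%nat).
  pose proof (INR_S_pos N) as hSN.
  assert (hn : INR n = INR q * INR (S N)) by apply mult_INR.
  assert (hn0 : 0 < INR n) by (rewrite hn; apply Rmult_lt_0_compat; lra).
  assert (hm : INR (S m) = (INR q - 2) * INR (S N)).
  { replace (S m) with ((q - 2) * S N)%nat by (unfold m; nia).
    rewrite mult_INR, minus_INR by lia. reflexivity. }
  assert (ha : / INR q = INR (S N) / INR n) by (rewrite hn; field; lra).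
  assert (hend : / INR q + INR (S m) * / INR n = 1 - / INR q) by (rewrite hm, hn; field; lra).
  assert (hih : 0 < / INR n) by (apply Rinv_0_lt_compat; auto).
  assert (hsmall : / INR n < delta).
  { rewrite <- (Rinv_inv delta). apply Rinv_lt_contravar.
    - apply Rmult_lt_0_compat; [apply Rinv_0_lt_compat, cond_pos|auto].
    - assert (INR M' + 1 <= INR (S N)) by (rewrite <- S_INR; apply le_INR; lia).
      rewrite hn. nra. }
  rewrite scal_sum.
  rewrite (sum_eq _ (fun i => (rho p (n - (S N + i)) *
   (Rpower (1 - INR (S N + i) / INR n) (p - 1) * Rpower (INR (S N + i) / INR n) (b - 1)
    * wapprox beta b (S N + i) (x * Rpower (INR (S N + i) / INR n) (- beta)))) * / INR n)).
  2:{ intros i hi. rewrite Rmult_comm. etransitivity; [|apply Rmult_comm].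
      apply (middle_term beta b p x q (S N) i); auto; lia. }
  rewrite <- scal_sum, Rabs_minus_sym, <- hend.
  apply Rle_lt_trans with (INR (S m) * / INR n * (eps / 2)).
  2:{ assert (INR (S m) * / INR n <= 1) by lra.
      assert (0 <= INR (S m) * / INR n) by (apply Rmult_le_pos; [apply pos_INR|lra]). nra. }
  apply riemann_sum_close; [lra| |].
  { intros t ht. apply continuous_kern; try lra. }
  intros i t hi ht.
  assert (hx0 : INR (S N + i) / INR n = / INR q + INR i * / INR n).
  { rewrite plus_INR, ha. field; lra. }
  assert (hi0 : 0 <= INR i) by apply pos_INR.
  assert (hii : INR i + 1 <= INR (S m)) by (rewrite <- S_INR; apply le_INR; lia).
  rewrite S_INR in ht.
  assert (hii2 : (INR i + 1) * / INR n <= INR (S m) * / INR n) by (apply Rmult_le_compat_r; lra).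
  assert (0 <= INR i * / INR n) by (apply Rmult_le_pos; lra).
  set (tau := INR (S N + i) / INR n) in *.
  assert (hA : Rabs (kern beta b p x t - kern beta b p x tau) < eps / 4).
  { apply hdelta; try lra. apply Rabs_def1; lra. }
  assert (hmn : (S N + i < n)%nat) by (unfold n; nia).
  assert (hM1 : (S N <= n - (S N + i))%nat) by (unfold n, m in *; nia).
  specialize (hM (n - (S N + i) - 1)%nat (N + i)%nat tau ltac:(lia) ltac:(lia) ltac:(lra)).
  replace (S (n - (S N + i) - 1)) with (n - (S N + i))%nat in hM by lia.
  change (S (N + i)) with (S N + i)%nat in hM.
  match goal with |- Rabs (?a - ?c) <= _ =>
    replace (a - c) with ((a - kern beta b p x tau) + (kern beta b p x tau - c)) by ring end.
  eapply Rle_trans; [apply Rabs_triang|]. lra.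
Qed.

Lemma wapprox_lim_mul (beta b x : R) (q : nat) : 0 < beta < / 2 -> 0 <= b -> (1 <= q)%nat ->
  is_lim_seq (fun N => wapprox beta b (q * S N) x) (Wright (- x) (- beta) b).
Proof.
  intros hbeta hb hq.
  apply (is_lim_seq_ext (fun N => wapprox beta b (S (q * S N - 1)) x)).
  { intros N. f_equal. nia. }
  apply (is_lim_seq_subseq (fun m => wapprox beta b (S m) x) _ (fun N => (q * S N - 1)%nat)).
  - intros P [M hM]. exists M. intros N hN. apply hM. nia.
  - apply wapprox_lim; auto.
Qed.

(** Here q is fixed and N tends to infinity. The lower bound holds because both tails are
    nonnegative; [C1] and [C2] do not depend on q, which may therefore grow afterwards. *)
Lemma kern_RInt_bounds (beta b p x : R) :
  0 < beta < / 2 -> 0 <= b <= 1 -> 0 < p <= 1 -> 0 <= x ->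
  exists C1 C2, 0 <= C1 /\ forall q, (3 <= q)%nat ->
  let J := RInt (kern beta b p x) (/ INR q) (1 - / INR q) in
  J <= Wright (- x) (- beta) (b + p) <=
  J + C1 * (Rpower (INR q) (- b) * Wright (- (x * Rpower (INR q) beta)) (- beta) (b + 1))
    + C2 * Rpower (INR q) (- p).
Proof.
  intros hbeta hb hp hx.
  destruct (right_tail beta b p x hbeta hb hp hx) as [C2 [hC2 hright]].
  set (C1 := p * exp p * Rpower (/ 2) (p - 1)).
  exists C1, C2. split.
  { apply Rmult_le_pos; [apply Rmult_le_pos; [lra|apply Rlt_le, exp_pos]|apply Rlt_le, Rpower_pos]. }
  intros q hq J.
  pose proof (middle_lim beta b p x q hbeta hb hp hx hq) as hmid. fold J in hmid.
  set (Mid := fun N => _) in hmid.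
  assert (split : forall N, exists L Rt,
    wapprox beta (b + p) (q * S N) x = L + Mid N + Rt /\ 0 <= L /\ 0 <= Rt /\
    L <= C1 * (Rpower (INR q) (- b) * wapprox beta (b + 1) (S N) (x * Rpower (INR q) beta)) /\
    Rt <= C2 * Rpower (INR q) (- p)).
  { intros N. set (n := (q * S N)%nat). set (y := x * Rpower (INR n) beta).
    set (t := fun k => rise p (n - k) * gcoef beta b y k).
    assert (ht : forall k, 0 <= t k).
    { intros k. apply Rmult_le_pos; [apply rise_nonneg; lra|]. apply gcoef_nonneg; try lra.
      apply Rmult_le_pos; [auto|apply Rlt_le, Rpower_pos]. }
    exists (Rpower (INR n) (1 - b - p) * sum_f_R0 t (S N - 1)).
    exists (Rpower (INR n) (1 - b - p) * sum_f_R0 (fun i => t (n - S N + i)%nat) (S N)).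
    split; [|split; [|split; [|split]]].
    - unfold Mid. fold n. rewrite <- !Rmult_plus_distr_l.
      replace (wapprox beta (b + p) n x) with
        (Rpower (INR n) (1 - b - p) * gcoef beta (b + p) y n).
      + rewrite <- gcoef_conv by lra. f_equal.
        apply (sum_split3 t q (S N)); auto. lia.
      + replace (1 - b - p) with (1 - (b + p)) by ring. unfold y.
        replace n with (S (n - 1)) by (unfold n; nia). symmetry. apply wapprox_gcoef.
    - apply Rmult_le_pos; [apply Rlt_le, Rpower_pos|]. apply cond_pos_sum; auto.
    - apply Rmult_le_pos; [apply Rlt_le, Rpower_pos|]. apply cond_pos_sum; auto.
    - apply left_tail; auto; try lra; lia.
    - apply hright; auto. lia. }
  pose proof (wapprox_lim_mul beta (b + p) x q hbeta ltac:(lra) ltac:(lia)) as hV.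
  split.
  - apply (is_lim_seq_le Mid (fun N => wapprox beta (b + p) (q * S N) x) J
             (Wright (- x) (- beta) (b + p))); auto.
    intros N. destruct (split N) as (L & Rt & e & h1 & h2 & _). lra.
  - apply (is_lim_seq_le (fun N => wapprox beta (b + p) (q * S N) x)
      (fun N => Mid N
        + C1 * (Rpower (INR q) (- b) * wapprox beta (b + 1) (S N) (x * Rpower (INR q) beta))
        + C2 * Rpower (INR q) (- p))
      (Wright (- x) (- beta) (b + p))
      (J + C1 * (Rpower (INR q) (- b) * Wright (- (x * Rpower (INR q) beta)) (- beta) (b + 1))
         + C2 * Rpower (INR q) (- p))); auto.
    + intros N. destruct (split N) as (L & Rt & e & h1 & h2 & h3 & h4). lra.
    + apply is_lim_seq_plus'; [|apply is_lim_seq_const].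
      apply is_lim_seq_plus'; auto.
      apply (is_lim_seq_scal_l _ C1 (Rpower (INR q) (- b) * _)).
      apply (is_lim_seq_scal_l _ (Rpower (INR q) (- b)) (Wright _ _ _)).
      apply wapprox_lim; lra.
Qed.

(** For b > 0 the power q^(-b) suffices; for b = 0 the decay of W(-x; -beta, 1) replaces it. The
    case b = x = 0 is a true exception: the kernel vanishes, as 1 / Gamma(0) = 0, while W(0; -beta,
    p) = 1 / Gamma(p). *)
Lemma left_tail_lim (beta b x : R) : 0 < beta < / 2 -> 0 <= b -> 0 <= x -> 0 < b \/ 0 < x ->
  is_lim_seq (fun q => Rpower (INR (S q)) (- b)
     * Wright (- (x * Rpower (INR (S q)) beta)) (- beta) (b + 1)) 0.
Proof.
  intros hbeta hb hx h.
  assert (hz : forall q, 0 <= x * Rpower (INR (S q)) beta).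
  { intros q. apply Rmult_le_pos; [auto|apply Rlt_le, Rpower_pos]. }
  destruct (Rle_lt_or_eq_dec 0 b hb) as [hb0|<-].
  - apply (is_lim_seq_le_le (fun _ => 0) _ (fun q => Rpower (INR (S q)) (- b) * rgamma (b + 1))).
    + intros q. split.
      * apply Rmult_le_pos; [apply Rlt_le, Rpower_pos|]. apply Wright_nonneg; auto; lra.
      * apply Rmult_le_compat_l; [apply Rlt_le, Rpower_pos|].
        rewrite <- (Wright_0 (- beta) (b + 1)), <- Ropp_0.
        apply Wright_decr; try lra. split; [lra|auto].
    + apply is_lim_seq_const.
    + rewrite <- (Rmult_0_l (rgamma (b + 1))).
      apply (is_lim_seq_scal_r _ (rgamma (b + 1)) 0). apply Rpower_neg_lim_0; auto.
  - assert (hx0 : 0 < x) by lra.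
    apply (is_lim_seq_le_le (fun _ => 0) _
             (fun q => rgamma beta / (beta * x) * Rpower (INR (S q)) (- beta))).
    + intros q. rewrite Rplus_0_l, Ropp_0, Rpower_O, Rmult_1_l by apply INR_S_pos. split.
      * apply Wright_nonneg; auto; lra.
      * eapply Rle_trans; [apply Wright_1_decay; auto; apply Rmult_lt_0_compat; auto using Rpower_pos|].
        apply Req_le. rewrite Rpower_Ropp. field. repeat split; try lra.
        apply Rgt_not_eq, Rpower_pos.
    + apply is_lim_seq_const.
    + rewrite <- (Rmult_0_r (rgamma beta / (beta * x))).
      apply (is_lim_seq_scal_l _ _ 0). apply Rpower_neg_lim_0; lra.
Qed.

Lemma kern_RInt_lim (beta b p x eps : R) :
  0 < beta < / 2 -> 0 <= b <= 1 -> 0 < p <= 1 -> 0 <= x -> 0 < b \/ 0 < x -> 0 < eps ->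
  exists delta, 0 < delta < / 2 /\ forall u v, 0 < u < delta -> 1 - delta < v < 1 ->
  Rabs (RInt (kern beta b p x) u v - Wright (- x) (- beta) (b + p)) < eps.
Proof.
  intros hbeta hb hp hx hor heps.
  destruct (kern_RInt_bounds beta b p x hbeta hb hp hx) as (C1 & C2 & hC1 & hbd).
  pose proof (left_tail_lim beta b x hbeta ltac:(lra) hx hor) as hl.
  assert (htail : is_lim_seq (fun q =>
    C1 * (Rpower (INR (S q)) (- b) * Wright (- (x * Rpower (INR (S q)) beta)) (- beta) (b + 1))
    + C2 * Rpower (INR (S q)) (- p)) 0).
  { replace (Finite 0) with (Finite (C1 * 0 + C2 * 0)) by (f_equal; ring).
    apply is_lim_seq_plus'.
    - apply (is_lim_seq_scal_l _ C1 0); auto.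
    - apply (is_lim_seq_scal_l _ C2 0). apply Rpower_neg_lim_0; lra. }
  apply is_lim_seq_spec in htail. destruct (htail (mkposreal eps heps)) as [q0 hq0].
  simpl pos in hq0.
  set (q := S (Nat.max q0 2)). specialize (hq0 (Nat.max q0 2) ltac:(lia)). fold q in hq0.
  rewrite Rminus_0_r in hq0. apply Rabs_def2 in hq0.
  assert (hq3 : (3 <= q)%nat) by (unfold q; lia).
  destruct (hbd q hq3) as [_ hup]. cbv zeta in hup.
  assert (hqR : 3 <= INR q) by (replace 3 with (INR 3) by (simpl; ring); apply le_INR; auto).
  assert (hiq : 0 < / INR q) by (apply Rinv_0_lt_compat; lra).
  assert (hiq3 : / INR q <= / 3) by (apply Rinv_le_contravar; lra).
  exists (/ INR q). split; [lra|]. intros u v hu hv.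
  assert (h1 : RInt (kern beta b p x) (/ INR q) (1 - / INR q) <= RInt (kern beta b p x) u v)
    by (apply RInt_kern_mono; lra).
  (* Some [1 / r, 1 - 1 / r] contains [u, v], and the kernel is nonnegative. *)
  assert (h2 : RInt (kern beta b p x) u v <= Wright (- x) (- beta) (b + p)).
  { set (e := Rmin u (1 - v)).
    assert (he : 0 < e /\ e <= u /\ e <= 1 - v).
    { repeat split; [apply Rmin_case; lra|apply Rmin_l|apply Rmin_r]. }
    destruct (nfloor_ex (/ e)) as [M hM]; [apply Rlt_le, Rinv_0_lt_compat; lra|].
    set (r := S (Nat.max M 2)). assert (hr : (3 <= r)%nat) by (unfold r; lia).
    destruct (hbd r hr) as [hlo _]. cbv zeta in hlo.
    assert (hrR : INR M + 1 <= INR r) by (rewrite <- S_INR; apply le_INR; unfold r; lia).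
    assert (hre : / INR r <= e).
    { rewrite <- (Rinv_inv e). apply Rinv_le_contravar; [apply Rinv_0_lt_compat; lra|lra]. }
    assert (0 < / INR r) by (apply Rinv_0_lt_compat, lt_0_INR; lia).
    eapply Rle_trans; [|apply hlo]. apply RInt_kern_mono; lra. }
  apply Rabs_def1; lra.
Qed.

(** * Caputo derivatives *)

(** The substitution tau = t s carries the Caputo integral to [kern] with p = 1 - 2 beta and x = X
    t^(-beta); the assumed form of f' is stable under this scaling. *)
Lemma is_caputo_Wright (beta b A X t : R) (f : R -> R) :
  0 < beta < / 2 -> 0 <= b <= 1 -> 0 <= X -> 0 < b \/ 0 < X -> 0 < t ->
  (forall tau, 0 < tau < t -> is_derive f tau
     (A * (Rpower tau (b - 1) * Wright (- (X * Rpower tau (- beta))) (- beta) b))) ->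
  is_caputo (2 * beta) f t
    (A * Rpower t (b - 2 * beta)
       * Wright (- (X * Rpower t (- beta))) (- beta) (b + 1 - 2 * beta)).
Proof.
  intros hbeta hb hX hor ht hf. split.
  { intros tau htau. eexists. apply hf; auto. }
  set (p := 1 - 2 * beta). set (x := X * Rpower t (- beta)).
  assert (hp : 0 < p <= 1) by (unfold p; lra).
  pose proof (rgamma_pos_unit p hp) as hg.
  assert (hx : 0 <= x) by (apply Rmult_le_pos; [auto|apply Rlt_le, Rpower_pos]).
  assert (hor' : 0 < b \/ 0 < x).
  { destruct hor; [auto|right; apply Rmult_lt_0_compat; auto using Rpower_pos]. }
  replace (b + 1 - 2 * beta) with (b + p) by (unfold p; ring).
  set (V := Wright (- x) (- beta) (b + p)).
  set (K := A * Rpower t (b - 2 * beta) / rgamma p).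
  exists (K * V). split.
  2:{ unfold Gamma. fold p. unfold K. field. lra. }
  intros P [eps hP].
  (* The [+ 1] keeps the divisor positive when A = 0. *)
  assert (hK : 0 < Rabs K + 1) by (pose proof (Rabs_pos K); lra).
  destruct (kern_RInt_lim beta b p x (eps / (Rabs K + 1))) as [d [hd hlim]]; auto.
  { apply Rdiv_lt_0_compat; [apply cond_pos|auto]. }
  assert (hdt : 0 < d * t) by nra.
  exists (fun u => 0 < u < d * t) (fun v => t - d * t < v < t).
  - exists (mkposreal _ hdt). intros u hu hu0. change (Rabs (u - 0) < d * t) in hu.
    apply Rabs_def2 in hu. lra.
  - exists (mkposreal _ hdt). intros v hv hv0. change (Rabs (v - t) < d * t) in hv.
    apply Rabs_def2 in hv. lra.
  - intros u v hu hv. simpl fst; simpl snd.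
    (* The [+ 0] matches the affine form required by [is_RInt_comp_lin]. *)
    assert (hut : 0 < / t * u + 0 < d).
    { rewrite Rplus_0_r, Rmult_comm. split; [apply Rdiv_lt_0_compat; lra|].
      apply Rlt_div_l; lra. }
    assert (hvt : 1 - d < / t * v + 0 < 1).
    { rewrite Rplus_0_r, Rmult_comm. split; [apply Rlt_div_r; lra|apply Rlt_div_l; lra]. }
    specialize (hlim _ _ hut hvt).
    set (J := RInt (kern beta b p x) (/ t * u + 0) (/ t * v + 0)) in *.
    exists (K * J). split.
    + assert (hJ : is_RInt (kern beta b p x) (/ t * u + 0) (/ t * v + 0) J).
      { apply (RInt_correct (kern beta b p x)), ex_RInt_kern; lra. }
      apply (is_RInt_comp_lin (kern beta b p x)) in hJ.
      apply (is_RInt_scal _ _ _ K) in hJ.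
      refine (is_RInt_ext _ _ _ _ _ _ hJ). intros tau htau.
      rewrite Rmin_left, Rmax_right in htau by nra.
      assert (h : 0 < tau < t) by lra.
      rewrite (is_derive_unique _ _ _ (hf tau h)).
      change (K * (/ t * kern beta b p x (/ t * tau + 0)) =
        A * (Rpower tau (b - 1) * Wright (- (X * Rpower tau (- beta))) (- beta) b)
        * Rpower (t - tau) (- (2 * beta))).
      unfold kern, K. rewrite Rplus_0_r.
      replace (1 - / t * tau) with (/ t * (t - tau)) by (field; lra).
      assert (hit : 0 < / t) by (apply Rinv_0_lt_compat; auto).
      rewrite <- !Rpower_mult_distr by lra.
      replace (p - 1) with (- (2 * beta)) by (unfold p; ring).
      replace (x * (Rpower (/ t) (- beta) * Rpower tau (- beta))) with (X * Rpower tau (- beta)).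
      2:{ unfold x. transitivity (X * (Rpower t (- beta) * Rpower (/ t) (- beta)) * Rpower tau (- beta)); [|ring].
          rewrite Rpower_mult_distr by auto. rewrite Rinv_r by lra.
          unfold Rpower at 2. rewrite ln_1, Rmult_0_r, exp_0. ring. }
      set (W := Wright _ _ _).
      assert (ep : Rpower t (b - 2 * beta) * / t * Rpower (/ t) (- (2 * beta)) * Rpower (/ t) (b - 1) = 1).
      { replace (/ t) with (Rpower t (- (1))) at 1 by (rewrite Rpower_Ropp, Rpower_1; auto).
        unfold Rpower. rewrite ln_Rinv by auto. rewrite <- !exp_plus, <- exp_0. f_equal. ring. }
      transitivity (A * (Rpower t (b - 2 * beta) * / t * Rpower (/ t) (- (2 * beta)) * Rpower (/ t) (b - 1))
        * (Rpower (t - tau) (- (2 * beta)) * Rpower tau (b - 1) * W)).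
      * field. split; lra.
      * rewrite ep. ring.
    + apply hP. change (Rabs (K * J - K * V) < eps).
      rewrite <- Rmult_minus_distr_l, Rabs_mult.
      apply Rle_lt_trans with ((Rabs K + 1) * Rabs (J - V)).
      { apply Rmult_le_compat_r; [apply Rabs_pos|lra]. }
      apply (Rmult_lt_compat_l (Rabs K + 1)) in hlim; auto.
      replace ((Rabs K + 1) * (eps / (Rabs K + 1))) with (pos eps) in hlim by (field; lra).
      exact hlim.
Qed.

Lemma tpow_Rpower (t a : R) : 0 < t -> tpow t a = Rpower t a.
Proof. intros ht. unfold tpow. destruct (Rlt_dec 0 t); [reflexivity|contradiction]. Qed.

Lemma tpow_0 (a : R) : tpow 0 a = 0.
Proof. unfold tpow. destruct (Rlt_dec 0 0); [lra|reflexivity]. Qed.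

Lemma locally_tpow (t a : R) : 0 < t -> locally t (fun u => Rpower u a = tpow u a).
Proof.
  intros ht. apply (filter_imp (fun u => 0 < u)).
  - intros u hu. symmetry; apply tpow_Rpower; auto.
  - apply open_gt; auto.
Qed.

(** The case X = 0, where the Wright factor is the constant 1 / Gamma(beta); since beta = Gamma(1 +
    beta) / Gamma(beta), the constant [A] is c Gamma(1 + beta). *)
Lemma is_caputo_tpow (beta c t : R) : 0 < beta < / 2 -> 0 < t ->
  is_caputo (2 * beta) (fun tau => c * tpow tau beta) t
    (c * rgamma (1 - beta) / rgamma (1 + beta) * Rpower t (- beta)).
Proof.
  intros hbeta ht.
  assert (hg : 0 < rgamma beta) by (apply rgamma_pos_unit; lra).
  assert (hr : rgamma beta = beta * rgamma (1 + beta)).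
  { rewrite rgamma_rec. do 2 f_equal. ring. }
  assert (hg1 : rgamma (1 + beta) <> 0) by (intros e; rewrite e in hr; lra).
  pose proof (is_caputo_Wright beta beta (c / rgamma (1 + beta)) 0 t (fun tau => c * tpow tau beta)
                hbeta ltac:(lra) ltac:(lra) ltac:(lra) ht) as h.
  replace (c * rgamma (1 - beta) / rgamma (1 + beta) * Rpower t (- beta)) with
    (c / rgamma (1 + beta) * Rpower t (beta - 2 * beta) *
      Wright (- (0 * Rpower t (- beta))) (- beta) (beta + 1 - 2 * beta)).
  2:{ rewrite Rmult_0_l, Ropp_0, Wright_0.
      replace (beta + 1 - 2 * beta) with (1 - beta) by ring.
      replace (beta - 2 * beta) with (- beta) by ring. field; auto. }
  apply h. intros tau htau.
  rewrite Rmult_0_l, Ropp_0, Wright_0, hr.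
  replace (c / rgamma (1 + beta) * (Rpower tau (beta - 1) * (beta * rgamma (1 + beta))))
    with (c * (beta * Rpower tau (beta - 1))) by (field; auto).
  apply (is_derive_scal (fun tau => tpow tau beta)).
  apply (is_derive_ext_loc (fun tau => Rpower tau beta)).
  - apply locally_tpow; lra.
  - apply is_derive_Rpower; lra.
Qed.

(** The chain rule gives (beta z / tau) M_beta(z), and beta z M_beta(z) = W(-z; -beta, 0) brings it
    to the form asked by [is_caputo_Wright], with b = 0. *)
Lemma is_derive_Wright_tau (beta X tau : R) : 0 < beta < / 2 -> 0 < tau ->
  is_derive (fun tau => Wright (- (X * Rpower tau (- beta))) (- beta) 1) tau
    (Rpower tau (0 - 1) * Wright (- (X * Rpower tau (- beta))) (- beta) 0).
Proof.
  intros hbeta ht.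
  rewrite <- Mainardi_Wright_0, Mainardi_Wright by auto.
  set (z := X * Rpower tau (- beta)).
  replace (Rpower tau (0 - 1) * (beta * z * Wright (- z) (- beta) (1 - beta))) with
    (X * (- beta * Rpower tau (- beta - 1)) * (- Wright (- z) (- beta) (1 - beta))).
  - apply (is_derive_comp (fun z => Wright (- z) (- beta) 1) (fun tau => X * Rpower tau (- beta))).
    + apply is_derive_Wright_opp; lra.
    + apply (is_derive_scal (fun tau => Rpower tau (- beta))). apply is_derive_Rpower; auto.
  - unfold z. replace (- beta - 1) with (- beta + (0 - 1)) by ring.
    rewrite (Rpower_plus (- beta)). ring.
Qed.

Lemma is_derive_profile (g : R -> R) (T0 C t l : R) : is_derive g t l ->
  is_derive (fun u => T0 - C * (1 - g u)) t (C * l).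
Proof.
  intros h. auto_derive; [exists l; auto|].
  change (Derive (fun x : R => g x) t) with (Derive g t).
  rewrite (is_derive_unique g t l h). ring.
Qed.

(** The history covers all of (0, t), including times before the front reaches x: the similarity
    formula itself is differentiated there. *)
Lemma is_caputo_temperature (beta T0 C lam x t : R) :
  0 < beta < / 2 -> 0 < lam -> 0 < x -> 0 < t ->
  is_caputo (2 * beta)
    (fun tau => T0 - C * (1 - Wright (- (x / (lam * tpow tau beta))) (- beta) 1)) t
    (C * Rpower t (- (2 * beta)) * Wright (- (x / (lam * Rpower t beta))) (- beta) (1 - 2 * beta)).
Proof.
  intros hbeta hlam hx ht.
  assert (hX : 0 < x / lam) by (apply Rdiv_lt_0_compat; auto).
  assert (ez : forall u, x / lam * Rpower u (- beta) = x / (lam * Rpower u beta)).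
  { intros u. rewrite Rpower_Ropp. pose proof (Rpower_pos u beta). field; lra. }
  pose proof (is_caputo_Wright beta 0 C (x / lam) t
    (fun tau => T0 - C * (1 - Wright (- (x / (lam * tpow tau beta))) (- beta) 1))
                hbeta ltac:(lra) ltac:(lra) ltac:(lra) ht) as h.
  rewrite ez in h.
  replace (0 + 1 - 2 * beta) with (1 - 2 * beta) in h by ring.
  replace (0 - 2 * beta) with (- (2 * beta)) in h by ring.
  apply h. intros tau htau.
  apply (is_derive_ext_loc (fun tau => T0 - C * (1 - Wright (- (x / lam * Rpower tau (- beta))) (- beta) 1))).
  { apply (filter_imp (fun u => Rpower u beta = tpow u beta)); [|apply locally_tpow; lra].
    intros u <-. rewrite ez. reflexivity. }
  apply (is_derive_profile (fun tau => Wright (- (x / lam * Rpower tau (- beta))) (- beta) 1)).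
  apply is_derive_Wright_tau; lra.
Qed.

Lemma is_derive_Wright_scale (beta b L y : R) : 0 < beta < / 2 -> 0 <= b ->
  is_derive (fun y => Wright (- (y / L)) (- beta) b) y (- / L * Wright (- (y / L)) (- beta) (b - beta)).
Proof.
  intros hbeta hb.
  replace (- / L * Wright (- (y / L)) (- beta) (b - beta)) with
    (/ L * - Wright (- (y / L)) (- beta) (b - beta)) by ring.
  apply (is_derive_comp (fun z => Wright (- z) (- beta) b) (fun y => y / L)).
  - apply is_derive_Wright_opp; auto.
  - unfold Rdiv. auto_derive; auto. ring.
Qed.

Lemma is_derive_temperature (beta T0 C L y : R) : 0 < beta < / 2 ->
  is_derive (fun y => T0 - C * (1 - Wright (- (y / L)) (- beta) 1)) y
    (- (C / L) * Wright (- (y / L)) (- beta) (1 - beta)).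
Proof.
  intros hbeta.
  replace (- (C / L) * Wright (- (y / L)) (- beta) (1 - beta))
    with (C * (- / L * Wright (- (y / L)) (- beta) (1 - beta))) by (unfold Rdiv; ring).
  apply (is_derive_profile (fun y => Wright (- (y / L)) (- beta) 1)).
  apply is_derive_Wright_scale; lra.
Qed.

(** Two space derivatives lower the last parameter from 1 to 1 - 2 beta, the one found in
    [is_caputo_temperature]: both sides of the diffusion equation are multiples of one function. *)
Lemma is_derive_2_temperature (beta T0 C L y : R) : 0 < beta < / 2 ->
  is_derive_n (fun y => T0 - C * (1 - Wright (- (y / L)) (- beta) 1)) 2 y
    (C / L ^ 2 * Wright (- (y / L)) (- beta) (1 - 2 * beta)).
Proof.
  intros hbeta. simpl.
  apply (is_derive_ext (fun y => - (C / L) * Wright (- (y / L)) (- beta) (1 - beta))).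
  { intros u. symmetry. apply is_derive_unique, is_derive_temperature; auto. }
  replace (C / (L * (L * 1)) * Wright (- (y / L)) (- beta) (1 - 2 * beta))
    with (- (C / L) * (- / L * Wright (- (y / L)) (- beta) (1 - beta - beta))).
  - apply (is_derive_scal (fun y => Wright (- (y / L)) (- beta) (1 - beta))).
    apply is_derive_Wright_scale; lra.
  - replace (1 - beta - beta) with (1 - 2 * beta) by ring.
    unfold Rdiv. rewrite Rmult_1_r, Rinv_mult. ring.
Qed.

(** * The free boundary problem *)

Lemma rgamma_succ_pos (beta : R) : 0 < beta <= 1 -> 0 < rgamma (1 + beta).
Proof.
  intros hbeta. pose proof (rgamma_pos_unit beta hbeta) as h. rewrite rgamma_rec in h.
  replace (beta + 1) with (1 + beta) in h by ring. nra.
Qed.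

(* Since [/ 0 = 0], a positive quotient has a nonzero denominator. *)
Lemma div_eq_pos (a m K : R) : 0 < K -> a / m = K -> m <> 0 /\ a = K * m.
Proof.
  intros hK h.
  assert (hm : m <> 0) by (intros ->; unfold Rdiv in h; rewrite Rinv_0 in h; lra).
  split; auto. rewrite <- h. field; auto.
Qed.

(** Only M_beta >= 0 is known, so the quotient is traded for the continuous [phi]; at a zero of
    [phi] M_beta cannot vanish, because x (1 - W) > 0. *)
Lemma front_equation (beta K : R) : 0 < beta < / 2 -> 0 < K ->
  exists! xi : R, 0 < xi /\
    xi * (1 - Wright (- xi) (- beta) 1) / Mainardi beta xi = K.
Proof.
  intros hbeta hK.
  set (W := fun x => Wright (- x) (- beta) 1). set (M := fun x => Wright (- x) (- beta) (1 - beta)).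
  change (exists! xi : R, 0 < xi /\ xi * (1 - W xi) / M xi = K).
  assert (hM : forall x y, 0 <= x <= y -> 0 <= M y <= M x).
  { intros x y h. split; [apply Wright_nonneg|apply Wright_decr]; lra. }
  assert (hW : forall x y, 0 <= x <= y -> W y <= W x) by (intros; apply Wright_decr; lra).
  assert (hW1 : forall x, 0 < x -> W x < 1) by (intros; apply Wright_1_lt_1; auto).
  set (phi := fun x => x * (1 - W x) - K * M x).
  assert (hphi : continuity phi).
  { intros x. apply continuity_pt_filterlim.
    apply (continuous_minus (fun x => x * (1 - W x)) (fun x => K * M x)).
    - apply (continuous_mult (fun x => x) (fun x => 1 - W x)); [apply continuous_id|].
      apply (continuous_minus (fun _ => 1) W); [apply continuous_const|apply continuous_Wright_opp; lra].
    - apply (continuous_mult (fun _ => K) M); [apply continuous_const|apply continuous_Wright_opp; lra]. }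
  assert (hM0 : 0 < M 0).
  { unfold M. rewrite Ropp_0, Wright_0. apply rgamma_pos_unit; lra. }
  assert (hw : 0 < 1 - W 1) by (pose proof (hW1 1 Rlt_0_1); lra).
  assert (hKM : 0 < K * M 0) by nra.
  (* By monotonicity phi(Y) >= Y (1 - W 1) - K M 0, and this choice makes the right side 1 - W 1 >
     0. *)
  set (Y := 1 + K * M 0 / (1 - W 1)).
  assert (hY : 1 < Y).
  { unfold Y. assert (0 < K * M 0 / (1 - W 1)) by (apply Rdiv_lt_0_compat; auto). lra. }
  assert (hphiY : 0 < phi Y).
  { unfold phi. pose proof (hM 0 Y ltac:(lra)). pose proof (hW 1 Y ltac:(lra)).
    assert (eY : Y * (1 - W 1) = (1 - W 1) + K * M 0) by (unfold Y; field; lra). nra. }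
  assert (hphi0 : phi 0 < 0) by (unfold phi; lra).
  destruct (IVT phi 0 Y hphi ltac:(lra) hphi0 hphiY) as [xi [hxi e]].
  assert (hxi0 : 0 < xi).
  { destruct (proj1 hxi) as [h|h]; [auto|]. rewrite <- h in e. lra. }
  unfold phi in e.
  exists xi. split.
  - split; auto. pose proof (hW1 xi hxi0).
    assert (M xi <> 0) by (intros h; rewrite h in e; nra).
    apply (Rmult_eq_reg_r (M xi)); auto. unfold Rdiv. rewrite Rmult_assoc, Rinv_l by auto. lra.
  - assert (lt : forall x y, 0 < x -> x < y ->
      x * (1 - W x) = K * M x -> y * (1 - W y) = K * M y -> False).
    { intros x y hx hxy ex ey. pose proof (hM x y ltac:(lra)). pose proof (hW x y ltac:(lra)).
      pose proof (hW1 x hx). nra. }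
    intros y [hy ey]. destruct (div_eq_pos _ _ _ hK ey) as [_ ey'].
    destruct (Rtotal_order xi y) as [h|[h|h]]; auto; exfalso.
    + apply (lt xi y); auto; lra.
    + apply (lt y xi); auto; lra.
Qed.

(** Each constant answers to one condition: [lam] to the flux at x = 0, [rho] to lam^2 = k / (rho
    c), and [xi] to the Stefan condition at the front. *)
Lemma similarity_solution (beta k c l Tm T0 q0 xi : R) :
  0 < beta < / 2 -> 0 < k -> 0 < c -> 0 < l -> Tm < T0 -> 0 < q0 -> 0 < xi ->
  xi * (1 - Wright (- xi) (- beta) 1) / Mainardi beta xi
  = c * (T0 - Tm) * Gamma (1 - beta) / (l * Gamma (1 + beta)) ->
  let Wxi := 1 - Wright (- xi) (- beta) 1 in
  let rho := q0 ^ 2 * Gamma (1 - beta) ^ 2 / (k * c * (T0 - Tm) ^ 2) * Wxi ^ 2 in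
  let lam := k * (T0 - Tm) / (q0 * Gamma (1 - beta) * Wxi) in
  stefan_solution (2 * beta) rho k c l Tm T0 q0
    (fun x t => T0 - (T0 - Tm) / Wxi *
              (1 - Wright (- (x / (lam * tpow t beta))) (- beta) 1))
    (fun t => lam * xi * tpow t beta).
Proof.
  intros hbeta hk hc hl hT hq hxi hE Wxi rho lam.
  assert (hW : 0 < Wxi) by (pose proof (Wright_1_lt_1 beta xi hbeta hxi); unfold Wxi; lra).
  assert (hr1 : 0 < rgamma (1 - beta)) by (apply rgamma_pos_unit; lra).
  assert (hr2 : 0 < rgamma (1 + beta)) by (apply rgamma_succ_pos; lra).
  unfold Gamma in *.
  set (g1 := rgamma (1 - beta)) in *. set (g2 := rgamma (1 + beta)) in *.
  assert (hi1 : 0 < / g1) by (apply Rinv_0_lt_compat; auto).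
  assert (hi2 : 0 < / g2) by (apply Rinv_0_lt_compat; auto).
  fold Wxi in hE.
  destruct (div_eq_pos (xi * Wxi) (Mainardi beta xi)
     (c * (T0 - Tm) * / g1 / (l * / g2))) as [hM hE']; auto.
  { apply Rdiv_lt_0_compat; [|nra]. apply Rmult_lt_0_compat; auto. nra. }
  set (DT := T0 - Tm) in *. assert (hDT : 0 < DT) by (unfold DT; lra).
  assert (hlam : 0 < lam).
  { apply Rdiv_lt_0_compat; [nra|]. repeat apply Rmult_lt_0_compat; auto. }
  assert (hrho : 0 < rho).
  { apply Rmult_lt_0_compat; [apply Rdiv_lt_0_compat|];
      repeat apply Rmult_lt_0_compat; auto using pow_lt; lra. }
  assert (hdiff : k / (rho * c) = lam ^ 2).
  { unfold rho, lam. field. repeat split; lra. }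
  assert (hflux : DT / Wxi / lam * g1 = q0 / k).
  { unfold lam. field. repeat split; lra. }
  assert (hS : forall t, 0 < t -> lam * xi * tpow t beta / (lam * tpow t beta) = xi).
  { intros t ht. rewrite tpow_Rpower by auto. pose proof (Rpower_pos t beta). field. lra. }
  (* From here [rho] and [lam] enter only through their positivity, [hdiff], [hflux] and [hS]. *)
  clearbody rho lam.
  split; [auto|]. split; [rewrite tpow_0; ring|]. split.
  { intros t ht. rewrite tpow_Rpower by auto.
    repeat apply Rmult_lt_0_compat; auto. apply Rpower_pos. }
  split.
  { intros x t ht hx.
    do 2 eexists. split; [apply is_caputo_temperature; auto; lra|].
    split; [apply is_derive_2_temperature; auto|].
    rewrite hdiff, tpow_Rpower by auto.
    replace (2 * beta) with (beta + beta) by ring.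
    rewrite Rpower_Ropp, Rpower_plus. pose proof (Rpower_pos t beta). field. lra. }
  split.
  (* At t = 0 the formula for T divides by 0 and would return T0; since s(0) = 0, every x > 0 lies
     in the solid branch. *)
  { intros x hx. unfold phase_field. rewrite tpow_0.
    destruct (Rle_dec x (lam * xi * 0)); [lra|reflexivity]. }
  split.
  { intros t ht. apply (is_lim_ext_loc (fun _ => Tm)); [|apply is_lim_const].
    exists (lam * xi * tpow t beta). intros x hx. unfold phase_field.
    destruct (Rle_dec x (lam * xi * tpow t beta)); [lra|reflexivity]. }
  split.
  { intros t ht. rewrite hS by auto. fold Wxi. unfold DT. field. lra. }
  split.
  { intros t ht. do 2 eexists.
    split; [apply is_derive_temperature; auto|].
    split; [apply is_caputo_tpow; auto|].
    rewrite hS by auto. rewrite <- Mainardi_Wright, tpow_Rpower, Rpower_Ropp by auto.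
    fold g1 g2. pose proof (Rpower_pos t beta).
    assert (hrl : rho * lam ^ 2 = k / c).
    { rewrite <- hdiff. field. lra. }
    (* The equation for [xi] without denominators: this is the Stefan condition once t^beta and
       [lam] are cleared. *)
    assert (hc2 : c * DT * Mainardi beta xi = l * xi * Wxi * g1 / g2).
    { transitivity (l * (xi * Wxi) * g1 / g2); [|unfold Rdiv; ring]. rewrite hE'. field. lra. }
    apply (Rmult_eq_reg_r (Rpower t beta * lam * c)); [|apply Rgt_not_eq; repeat apply Rmult_lt_0_compat; lra].
    transitivity (k / Wxi * (c * DT * Mainardi beta xi)).
    { field. lra. }
    rewrite hc2.
    transitivity (rho * lam ^ 2 * c * (l * xi * g1 / g2)); [rewrite hrl; field; lra|].
    field. lra. }
  split.
  { intros t ht. unfold Rdiv at 2. rewrite Rmult_0_l, Ropp_0, Wright_0, rgamma_1. ring. }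
  intros t ht. eexists. split; [apply is_derive_temperature; auto|].
  unfold Rdiv at 3. rewrite Rmult_0_l, Ropp_0, Wright_0. fold g1.
  replace (2 * beta / 2) with beta by field. rewrite !tpow_Rpower by auto.
  pose proof (Rpower_pos t beta).
  transitivity (- k * (DT / Wxi / lam * g1) / Rpower t beta); [field; lra|].
  rewrite hflux. field. lra.
Qed.

Theorem theorem8 (alpha k c l Tm T0 q0 : R)
  (halpha : 0 < alpha < 1) (hk : 0 < k) (hc : 0 < c) (hl : 0 < l)
  (hT : Tm < T0) (hq : 0 < q0) :
  (exists! xi : R, 0 < xi /\
     xi * (1 - Wright (- xi) (- (alpha / 2)) 1) / Mainardi (alpha / 2) xi
     = c * (T0 - Tm) * Gamma (1 - alpha / 2) / (l * Gamma (1 + alpha / 2)))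
  /\
  (forall xi : R, 0 < xi ->
     xi * (1 - Wright (- xi) (- (alpha / 2)) 1) / Mainardi (alpha / 2) xi
     = c * (T0 - Tm) * Gamma (1 - alpha / 2) / (l * Gamma (1 + alpha / 2)) ->
   let Wxi := 1 - Wright (- xi) (- (alpha / 2)) 1 in
   let rho := q0 ^ 2 * Gamma (1 - alpha / 2) ^ 2 / (k * c * (T0 - Tm) ^ 2)
              * Wxi ^ 2 in
   let lam := k * (T0 - Tm) / (q0 * Gamma (1 - alpha / 2) * Wxi) in
   let T := fun x t => T0 - (T0 - Tm) / Wxi *
              (1 - Wright (- (x / (lam * tpow t (alpha / 2)))) (- (alpha / 2)) 1) in
   let s := fun t => lam * xi * tpow t (alpha / 2) in
   stefan_solution alpha rho k c l Tm T0 q0 T s).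
Proof.
  assert (hbeta : 0 < alpha / 2 < / 2) by lra.
  split.
  - apply front_equation; auto.
    assert (0 < / rgamma (1 - alpha / 2)) by (apply Rinv_0_lt_compat, rgamma_pos_unit; lra).
    assert (0 < / rgamma (1 + alpha / 2)) by (apply Rinv_0_lt_compat, rgamma_succ_pos; lra).
    apply Rdiv_lt_0_compat; repeat apply Rmult_lt_0_compat; auto; lra.
  - intros xi hxi hE Wxi rho lam T s.
    replace alpha with (2 * (alpha / 2)) at 1 by field.
    apply similarity_solution; auto.
Qed.
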